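(* Let $\beta$ be the OGD-CB algorithm. When $\mathbb E_{v\sim F,p\sim G}[p\mathbf 1[v\ge p]]\le\rho$, under full or partial information feedback, \[\Big|\mathbb E_{\bm v,\bm p,\bm\gamma}\big[R^{\mathrm{thr}}\big]-\mathbb E_{\bm v,\bm p}\big[R^{\mathrm{pac}}\big]\Big|=O\big(\sqrt{T\log T}\big),\qquad \Big|\mathbb E_{\bm v,\bm p}\big[R^{\beta}\big]-\mathbb E_{\bm v,\bm p}\big[R^{\mathrm{pac}}\big]\Big|=O\big(\sqrt{T\log T}\big).\]
   Context: Model: constants $\bar v>0$, $\rho\in(0,\bar v]$; $T$ rounds; budget $B=\rho T$. Values $v_t$ i.i.d. from $F$ on $[0,\bar v]$; highest competing bids $p_t$ i.i.d. from $G$ on $[0,\bar v]$, independent of values, unknown to the buyer. Throttling: each round the buyer chooses $x_t\in\{0,1\}$ after seeing $v_t$, receiving $x_tr_t$, $r_t=(v_t-p_t)^+$, and paying $x_tc_t$, $c_t=p_t\mathbf 1[v_t\ge p_t]$; an online throttling strategy sets $x_t=\beta_t(\mathcal H_t,v_t,\gamma_t)$ with internal randomness and history of past values, decisions and observed bids (full information: $p_t$ always observed; partial: only when $x_t=1$), keeping payment within $B$; revenue $\sum_{t=1}^{T_0}x_tr_t$, $T_0$ the ending time. $R^{\mathrm{thr}}$: revenue of the throttling strategy maximizing expected revenue. $R^{\mathrm{pac}}$: revenue of the adaptive pacing strategy of Balseiro and Gur (2019): step size $\varepsilon$ of order $T^{-1/2}$, cap $\bar\mu\ge\bar v/\rho$,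 $\mu_1\in[0,\bar\mu]$, $\tilde B_1=B$; each round bid $b_t=\min\{v_t/(1+\mu_t),\tilde B_t\}$ (win iff $b_t\ge p_t$, pay $p_t$, gain $v_t-p_t$), expenditure $z_t=p_t\mathbf 1[b_t\ge p_t]$, update $\mu_{t+1}=\mathrm{Proj}_{[0,\bar\mu]}(\mu_t-\varepsilon(\rho-z_t))$, $\tilde B_{t+1}=\tilde B_t-z_t$. OGD-CB algorithm: $\mathcal I_1=\emptyset$, $B_1=B$, $\lambda_1=0$. For $t=1,\dots,T$: observe $v_t$. If $t=1$: $x_1=1$, $\lambda_2=\lambda_1$. Otherwise: $\epsilon_t=\sqrt{(\ln 2+2\ln T)/(2|\mathcal I_t|)}$; $\tilde r_t(v)=\frac1{|\mathcal I_t|}\sum_{\tau\in\mathcal I_t}(v-p_\tau)^++\epsilon_tv$; $\tilde c_t(v)=\frac1{|\mathcal I_t|}\sum_{\tau\in\mathcal I_t}p_\tau\mathbf 1[v\ge p_\tau]-2\epsilon_tv$; $x_t=\mathbf 1[\tilde r_t(v_t)\ge\lambda_t\tilde c_t(v_t)]$; $\eta_t=1/(\bar v\sqrt t)$; $\lambda_{t+1}=(\lambda_t+\eta_t(x_t\tilde c_t(v_t)-\rho))^+$. If (full information) or (partial and $x_t=1$) observe $p_t$ and set $\mathcal I_{t+1}=\mathcal I_t\cup\{t\}$, else $\mathcal I_{t+1}=\mathcal I_t$. Set $B_{t+1}=B_t-x_tc_t$; if $B_{t+1}<\bar v$, stop. *)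

(* Defs.v *)
From HB Require Import structures.
From mathcomp Require Import all_boot all_order all_algebra.
From mathcomp Require Import all_classical all_reals all_analysis.
Set Implicit Arguments.
Unset Strict Implicit.
Unset Printing Implicit Defensive.
Import Order.TTheory GRing.Theory Num.Theory.
Local Open Scope classical_set_scope.
Local Open Scope ring_scope.

Section Model.
Variable R : realType.

(* Rounds are indexed 0 .. T-1 (round t here is round t+1 of the paper).
   A realization is given by sequences v p g : nat -> R
   (values, highest competing bids, internal randomness). *)

Definition scons (a : R) (s : nat -> R) : nat -> R :=
  fun i => if i is i'.+1 then s i' else a.

Definition rwd (v p : R) : R := Num.max (v - p) 0.
Definition cost (v p : R) : R := if p <= v then p else 0.

(* Expectation over T i.i.d. rounds (v_t ~ F, p_t ~ G, gamma_t ~ Unif[0,1],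
   all independent), written as an iterated Lebesgue integral. *)
Fixpoint expect_vpg (F G : probability R R) (n : nat)
    (f : (nat -> R) -> (nat -> R) -> (nat -> R) -> \bar R) : \bar R :=
  match n with
  | 0 => f (fun _ => 0) (fun _ => 0) (fun _ => 0)
  | n'.+1 => (\int[F]_v0 \int[G]_p0 \int[lebesgue_measure]_(g0 in `[0%R, 1%R])
               expect_vpg F G n'
                 (fun v p g => f (scons v0 v) (scons p0 p) (scons g0 g)))%E
  end.

Fixpoint expect_vp (F G : probability R R) (n : nat)
    (f : (nat -> R) -> (nat -> R) -> \bar R) : \bar R :=
  match n with
  | 0 => f (fun _ => 0) (fun _ => 0)
  | n'.+1 => (\int[F]_v0 \int[G]_p0
               expect_vp F G n' (fun v p => f (scons v0 v) (scons p0 p)))%E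
  end.

(* History at (0-based) round t: past values, past decisions, past      *)
(* observed bids (an unobserved bid is recorded as 0; whether it was    *)
(* observed is determined by the recorded decision and the feedback).   *)
Definition history (t : nat) : Type :=
  ((t.-tuple R * t.-tuple bool) * t.-tuple R)%type.

(* x_t = beta t (H_t, (v_t, gamma_t)) *)
Definition thr_strategy : Type := forall t : nat, history t * (R * R) -> bool.

(* info = true : full information ; info = false : partial information *)
Definition mk_hist (info : bool) (t : nat) (v p : nat -> R) (xs : seq bool)
  : history t :=
  ((mktuple (fun i : 'I_t => v i), mktuple (fun i : 'I_t => nth false xs i)),
   mktuple (fun i : 'I_t => if info || nth false xs i then p i else 0)).

Fixpoint thr_decs (beta : thr_strategy) (info : bool) (v p g : nat -> R)
    (t : nat) : seq bool :=
  match t with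
  | 0 => [::]
  | t'.+1 => let xs := thr_decs beta info v p g t' in
             rcons xs (beta t' (mk_hist info t' v p xs, (v t', g t')))
  end.

Definition thr_x beta info v p g (t : nat) : bool :=
  nth false (thr_decs beta info v p g t.+1) t.

Definition thr_revenue (T : nat) beta info v p g : R :=
  \sum_(t < T) (thr_x beta info v p g t)%:R * rwd (v t) (p t).

Definition thr_payment (T : nat) beta info v p g : R :=
  \sum_(t < T) (thr_x beta info v p g t)%:R * cost (v t) (p t).

Definition thr_admissible (vbar B : R) (T : nat) (beta : thr_strategy)
    (info : bool) : Prop :=
  forall v p g : nat -> R,
    (forall t, 0 <= v t <= vbar) -> (forall t, 0 <= p t <= vbar) ->
    (forall t, 0 <= g t <= 1) ->
    thr_payment T beta info v p g <= B.

Definition thr_measurable (beta : thr_strategy) : Prop :=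
  forall t, measurable_fun setT (beta t).

Definition E_thr (F G : probability R R) (vbar rho : R) (T : nat)
    (info : bool) : \bar R :=
  ereal_sup [set expect_vpg F G T
                   (fun v p g => (thr_revenue T beta info v p g)%:E)
            | beta in [set b | thr_measurable b /\
                               thr_admissible vbar (rho * T%:R) T b info]].

(* Adaptive pacing (Balseiro and Gur 2019).  State (mu_t, Btilde_t).   *)
Fixpoint pac_state (eps mubar mu1 rho B : R) (v p : nat -> R) (t : nat)
  : R * R :=
  match t with
  | 0 => (mu1, B)
  | t'.+1 =>
      let (mu, Bt) := pac_state eps mubar mu1 rho B v p t' in
      let b := Num.min (v t' / (1 + mu)) Bt in
      let z := if p t' <= b then p t' else 0 in
      (Num.min (Num.max (mu - eps * (rho - z)) 0) mubar, Bt - z)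
  end.

Definition pac_gain (eps mubar mu1 rho B : R) (v p : nat -> R) (t : nat) : R :=
  let (mu, Bt) := pac_state eps mubar mu1 rho B v p t in
  let b := Num.min (v t / (1 + mu)) Bt in
  if p t <= b then v t - p t else 0.

Definition pac_revenue (eps mubar mu1 rho : R) (T : nat) (v p : nat -> R) : R :=
  \sum_(t < T) pac_gain eps mubar mu1 rho (rho * T%:R) v p t.

Definition E_pac (F G : probability R R) (eps mubar mu1 rho : R) (T : nat)
  : \bar R :=
  expect_vp F G T (fun v p => (pac_revenue eps mubar mu1 rho T v p)%:E).

Definition ogd_eps (T n : nat) : R :=
  Num.sqrt ((ln 2 + 2 * ln T%:R) / (2 * n%:R)).

Definition r_tilde (T : nat) (Iobs : seq nat) (p : nat -> R) (x : R) : R :=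
  (\sum_(tau <- Iobs) rwd x (p tau)) / (size Iobs)%:R + ogd_eps T (size Iobs) * x.

Definition c_tilde (T : nat) (Iobs : seq nat) (p : nat -> R) (x : R) : R :=
  (\sum_(tau <- Iobs) cost x (p tau)) / (size Iobs)%:R - 2 * ogd_eps T (size Iobs) * x.

Definition ogd_decision (T : nat) (st : seq nat * R * R * bool) (t : nat)
    (p : nat -> R) (vt : R) : bool :=
  let '(Iobs, lam, _, stopped) := st in
  if stopped then false
  else if t == 0%N then true
  else lam * c_tilde T Iobs p vt <= r_tilde T Iobs p vt.

Fixpoint ogd_state (info : bool) (vbar rho : R) (T : nat) (v p : nat -> R)
    (t : nat) : seq nat * R * R * bool :=
  match t with
  | 0 => ([::], 0, rho * T%:R, false)
  | t'.+1 =>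
      let st := ogd_state info vbar rho T v p t' in
      let '(Iobs, lam, B, stopped) := st in
      if stopped then st else
      let x := ogd_decision T st t' p (v t') in
      let lam' := if t' == 0%N then lam else
          Num.max (lam + (vbar * Num.sqrt (t'.+1)%:R)^-1
                           * (x%:R * c_tilde T Iobs p (v t') - rho)) 0 in
      let Iobs' := if info || x then rcons Iobs t' else Iobs in
      let B' := B - x%:R * cost (v t') (p t') in
      (Iobs', lam', B', B' < vbar)
  end.

Definition ogd_x info vbar rho T (v p : nat -> R) (t : nat) : bool :=
  ogd_decision T (ogd_state info vbar rho T v p t) t p (v t).

Definition ogd_revenue (info : bool) (vbar rho : R) (T : nat) (v p : nat -> R)
  : R :=
  \sum_(t < T) (ogd_x info vbar rho T v p t)%:R * rwd (v t) (p t).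

Definition E_ogd (F G : probability R R) (info : bool) (vbar rho : R) (T : nat)
  : \bar R :=
  expect_vp F G T (fun v p => (ogd_revenue info vbar rho T v p)%:E).

End Model.

(* Main.v *)
Require Import Defs.
From HB Require Import structures.
From mathcomp Require Import all_boot all_order all_algebra.
From mathcomp Require Import all_classical all_reals all_analysis.
From mathcomp Require Import measurable_realfun ring lra.
Import Order.TTheory GRing.Theory Num.Theory.
Local Open Scope classical_set_scope.
Local Open Scope ring_scope.
Set Implicit Arguments.
Unset Strict Implicit.
Unset Printing Implicit Defensive.

(* Write [r] for [E[(v - p)^+]].  Each of the three revenues is at most
   [sum_t (v_t - p_t)^+], hence at most [T r] in expectation, so it suffices to
   show that each one is at least [T r - O(sqrt (T log T))].  For each
   algorithm a pathwise inequality
     [revenue >= T r - loss + sum_t D_t]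
   is proved, where [D_t] are martingale differences; integrating it round by
   round yields the expected lower bound.  Pathwise, the dual multiplier of
   pacing and of OGD-CB has small regret against [0] (the optimal multiplier
   when [E[p 1[v >= p]] <= rho]) and stays bounded, which bounds overspending
   and therefore the number of rounds lost after the budget is exhausted.  The
   throttling lower bound is attained by accepting every round while the budget
   lasts.

   For OGD-CB under partial feedback no concentration inequality is needed:
   rejections lower the multiplier and can only happen when it is positive, so
   the number of observations by round [t] is deterministically at least a
   constant times [t].  Second moments of the estimation errors, which grow
   like martingale variances, then suffice. *)

(** * Integration over the box of admissible values *)

Section Clamp.
Context {R : realType}.
Variable vbar : R.

(** The pathwise inequalities have to be linear in martingale differences, whereas the natural
    losses are not: a budget is exhausted early because a centered sum is large, and an estimate
    errs by the absolute value of one. For throttling and OGD-CB both are linearized by Young's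
    inequality [N <= a / 2 + N ^+ 2 / (2 * a)], completed as a square; expanding the square round by
    round leaves cross terms of mean zero and a deterministic variance. The weight [a] is the
    standard-deviation scale, [vbar * sqrt T] for spending and [vbar * sqrt t] for an estimate at
    round [t], so both halves have the same order. Pacing does without this, since its multiplier
    records actual payments and bounds the spending outright. A decision sees the current value but
    not the current bid, so noise is split into bid noise given the value and value noise. All
    losses are of order [sqrt T] except the accumulated confidence widths of OGD-CB, which alone
    produce the factor [sqrt (log T)]. *)

Definition inbox (x : R) : Prop := 0 <= x <= vbar.

(** Functions are composed with this retraction, so that they become bounded on the whole line while
    keeping their values on the box, which carries all the mass. *)
Definition clamp (x : R) : R := Num.min (Num.max x 0) vbar.

Lemma clamp_box x : 0 < vbar -> inbox (clamp x).
Proof.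
move=> v0; rewrite /inbox /clamp le_min le_max lexx orbT ge_min lexx orbT.
by rewrite (ltW v0).
Qed.

Lemma clamp_id x : inbox x -> clamp x = x.
Proof. by move=> /andP[x0 xv]; rewrite /clamp max_l// min_l. Qed.

Lemma measurable_clamp : measurable_fun setT clamp.
Proof. by apply: measurable_minr => //; exact: measurable_maxr. Qed.

End Clamp.

Section IntegralNonMeasurable.
Context d (T : measurableType d) {R : realType}.
Variables (mu : {measure set T -> \bar R}) (D : set T).
Hypotheses (mD : measurable D) (D0 : mu (~` D) = 0%E).
Local Open Scope ereal_scope.
Import HBNNSimple.

(** A simple function below [f] is multiplied by the indicator of [D]: it then lies below [g]
    everywhere, and its integral is unchanged because the complement of [D] is null. Comparing the
    suprema that define both integrals needs no more. *)
Let le_integral_pos (f g : T -> \bar R) :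
  (forall x, 0 <= f x) -> (forall x, 0 <= g x) -> (forall x, D x -> f x <= g x) ->
  \int[mu]_x f x <= \int[mu]_x g x.
Proof.
move=> f0 g0 fg; rewrite !ge0_integralTE//.
apply: ge_ereal_sup => _ /= [h hf <-].
apply: ereal_sup_ubound; exists (proj_nnsfun h mD) => /=.
  move=> x; rewrite /= /mindic /= indicE; case: (boolP (x \in D)) => /= xD.
    by rewrite mulr1 (le_trans (hf x))// fg//; exact: set_mem.
  by rewrite mulr0.
rewrite -!integralT_nnsfun.
apply: ae_eq_integral => //; try by apply/measurable_EFinP.
exists (~` D); split=> //; first exact: measurableC.
move=> x /= H Dx; apply: H => _.
by rewrite /= /mindic /= indicE mem_set//= mulr1.
Qed.

(* The library's comparison lemmas demand measurability, which is unavailable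
   for iterated integrals of arbitrary functions. *)
Lemma le_integral_nonmeasurable (f g : T -> \bar R) :
  (forall x, D x -> 0 <= f x) -> (forall x, D x -> f x <= g x) ->
  \int[mu]_x f x <= \int[mu]_x g x.
Proof.
move=> f0 fg.
have negl0 h : (forall x, D x -> 0 <= h x) -> \int[mu]_x h^\- x = 0.
  move=> h0; apply/eqP; rewrite eq_le integral_ge0// andbT.
  rewrite -[leRHS](integral0 mu setT); apply: le_integral_pos => // x Dx.
  by rewrite funenegE ge_max lexx andbT leeNl oppe0 h0.
rewrite integralE [leRHS]integralE !negl0//; last first.
  by move=> x Dx; exact: le_trans (f0 _ Dx) (fg _ Dx).
rewrite !sube0; apply: le_integral_pos => // x Dx.
by rewrite !funeposE ge_max !le_max fg// lexx orbT.
Qed.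

End IntegralNonMeasurable.

(** * Bounded measurable functions on the box and their real-valued integrals *)

Section BoxIntegral.
Context {R : realType}.
Variable vbar : R.
Hypothesis vbar_gt0 : 0 < vbar.
Notation box := (inbox vbar).
Implicit Types (m : probability R R).

Definition bmeas1 (k : R -> R) : Prop :=
  measurable_fun setT (fun x => k (clamp vbar x)) /\
  exists M, forall x, box x -> `|k x| <= M.

Definition bmeas2 (h : R -> R -> R) : Prop :=
  measurable_fun setT (fun z : R * R => h (clamp vbar z.1) (clamp vbar z.2)) /\
  exists M, forall x y, box x -> box y -> `|h x y| <= M.

Definition boxint m (k : R -> R) : R := \int[m]_x k (clamp vbar x).

Lemma bmeas1_integrable m k : bmeas1 k ->
  m.-integrable setT (EFin \o (k \o clamp vbar)).
Proof.
move=> [mk [M kM]]; apply: measurable_bounded_integrable => //.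
- by rewrite -[X in (X < _)%E]/(m setT) probability_setT ltry.
- exists M; split; first exact: num_real.
  move=> N MN x _ /=; apply: (le_trans (kM _ _) (ltW MN)).
  exact: clamp_box.
Qed.

Lemma EFin_boxint m k : bmeas1 k ->
  (boxint m k)%:E = (\int[m]_x (k (clamp vbar x))%:E)%E.
Proof.
move=> bk; rewrite /boxint /Rintegral fineK//.
exact: (integrable_fin_num _ (bmeas1_integrable m bk)).
Qed.

Lemma bmeas1_cst c : bmeas1 (fun _ => c).
Proof. by split; [exact: measurable_cst|exists `|c|]. Qed.

Lemma bmeas1_id : bmeas1 (fun x => x).
Proof.
split; first exact: measurable_clamp.
by exists vbar => x /andP[x0 xv]; rewrite ger0_norm.
Qed.

Lemma bmeas1D k l : bmeas1 k -> bmeas1 l -> bmeas1 (fun x => k x + l x).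
Proof.
move=> [mk [M kM]] [ml [N lN]]; split; first exact: measurable_funD.
exists (M + N) => x bx; apply: (le_trans (ler_normD _ _)).
by apply: lerD; [exact: kM|exact: lN].
Qed.

Lemma bmeas1M k l : bmeas1 k -> bmeas1 l -> bmeas1 (fun x => k x * l x).
Proof.
move=> [mk [M kM]] [ml [N lN]]; split; first exact: measurable_funM.
exists (M * N) => x bx; rewrite normrM.
by apply: ler_pM => //; [exact: kM|exact: lN].
Qed.

Lemma bmeas1N k : bmeas1 k -> bmeas1 (fun x => - k x).
Proof.
move=> [mk [M kM]]; split; first exact: measurable_funN.
by exists M => x bx; rewrite normrN; exact: kM.
Qed.

Lemma bmeas1B k l : bmeas1 k -> bmeas1 l -> bmeas1 (fun x => k x - l x).
Proof. by move=> bk bl; apply: bmeas1D => //; exact: bmeas1N. Qed.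

Lemma bmeas1_sum (I : eqType) (s : seq I) (k : I -> R -> R) :
  (forall i, i \in s -> bmeas1 (k i)) -> bmeas1 (fun x => \sum_(i <- s) k i x).
Proof.
elim: s => [|i s IH] H.
  by under eq_fun do rewrite big_nil; exact: bmeas1_cst.
under eq_fun do rewrite big_cons.
apply: bmeas1D; first by apply: H; rewrite mem_head.
by apply: IH => j js; apply: H; rewrite inE js orbT.
Qed.

Lemma boxintD m k l : bmeas1 k -> bmeas1 l ->
  boxint m (fun x => k x + l x) = boxint m k + boxint m l.
Proof. by move=> bk bl; rewrite /boxint RintegralD//; exact: bmeas1_integrable. Qed.

Lemma boxintB m k l : bmeas1 k -> bmeas1 l ->
  boxint m (fun x => k x - l x) = boxint m k - boxint m l.
Proof. by move=> bk bl; rewrite /boxint RintegralB//; exact: bmeas1_integrable. Qed.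

Lemma boxintZ m c k : bmeas1 k ->
  boxint m (fun x => c * k x) = c * boxint m k.
Proof. by move=> bk; rewrite /boxint RintegralZl//; exact: bmeas1_integrable. Qed.

Lemma boxint_cst m c : boxint m (fun _ => c) = c.
Proof.
rewrite /boxint Rintegral_cst// [X in fine X](_ : _ = 1%E) ?mulr1//.
exact: (probability_setT m).
Qed.

Lemma eq_boxint m k l : (forall x, box x -> k x = l x) -> boxint m k = boxint m l.
Proof.
by move=> kl; apply: eq_Rintegral => x _; apply: kl; exact: clamp_box.
Qed.

Lemma le_boxint m k l : bmeas1 k -> bmeas1 l ->
  (forall x, box x -> k x <= l x) -> boxint m k <= boxint m l.
Proof.
move=> bk bl kl; apply: le_Rintegral => //; try exact: bmeas1_integrable.
by move=> x _; apply: kl; exact: clamp_box.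
Qed.

Lemma boxint_ge0 m k : (forall x, box x -> 0 <= k x) -> 0 <= boxint m k.
Proof. by move=> k0; apply: Rintegral_ge0 => x _; apply: k0; exact: clamp_box. Qed.

Lemma box_null m : m `[0, vbar]%classic = 1%E -> m (~` `[0, vbar]%classic) = 0%E.
Proof. by move=> m1; rewrite probability_setC ?m1 ?subee. Qed.

Lemma le_integral_box m (f g : R -> \bar R) : m `[0, vbar]%classic = 1%E ->
  (forall x, box x -> 0 <= f x)%E -> (forall x, box x -> f x <= g x)%E ->
  (\int[m]_x f x <= \int[m]_x g x)%E.
Proof.
move=> m1 f0 fg; apply: (@le_integral_nonmeasurable _ _ _ _ `[0, vbar]%classic) => //.
exact: box_null.
Qed.

Lemma boxint_le_integral m k (f : R -> \bar R) : m `[0, vbar]%classic = 1%E ->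
  bmeas1 k -> (forall x, box x -> 0 <= f x)%E ->
  (forall x, box x -> (k x)%:E <= f x)%E ->
  ((boxint m k)%:E <= \int[m]_x f x)%E.
Proof.
(* [k] may be negative: its negative part is discarded, and its positive part still lies below [f]
   because [f] is nonnegative on the box. *)
move=> m1 bk f0 kf; rewrite EFin_boxint// integralE.
apply: (@le_trans _ _ (\int[m]_x ((fun y => (k (clamp vbar y))%:E)^\+ x))%E).
  rewrite -[leRHS]sube0 leeB//; exact: integral_ge0.
apply: le_integral_box => // x bx; rewrite funeposE ge_max f0// andbT.
by rewrite clamp_id//; exact: kf.
Qed.

Lemma integral_le_boxint m k (f : R -> \bar R) : m `[0, vbar]%classic = 1%E ->
  bmeas1 k -> (forall x, box x -> 0 <= f x)%E ->
  (forall x, box x -> f x <= (k x)%:E)%E ->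
  (\int[m]_x f x <= (boxint m k)%:E)%E.
Proof.
move=> m1 bk f0 fk; rewrite EFin_boxint//.
by apply: le_integral_box => // x bx; rewrite clamp_id//; exact: fk.
Qed.

Lemma bmeas2_cst c : bmeas2 (fun _ _ => c).
Proof. by split; [exact: measurable_cst|exists `|c|]. Qed.

Lemma bmeas2D h l : bmeas2 h -> bmeas2 l -> bmeas2 (fun x y => h x y + l x y).
Proof.
move=> [mk [M kM]] [ml [N lN]]; split; first exact: measurable_funD.
exists (M + N) => x y bx bY; apply: (le_trans (ler_normD _ _)).
by apply: lerD; [exact: kM|exact: lN].
Qed.

Lemma bmeas2M h l : bmeas2 h -> bmeas2 l -> bmeas2 (fun x y => h x y * l x y).
Proof.
move=> [mk [M kM]] [ml [N lN]]; split; first exact: measurable_funM.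
exists (M * N) => x y bx bY; rewrite normrM.
by apply: ler_pM => //; [exact: kM|exact: lN].
Qed.

Lemma bmeas2N h : bmeas2 h -> bmeas2 (fun x y => - h x y).
Proof.
move=> [mk [M kM]]; split; first exact: measurable_funN.
by exists M => x y bx bY; rewrite normrN; exact: kM.
Qed.

Lemma bmeas2B h l : bmeas2 h -> bmeas2 l -> bmeas2 (fun x y => h x y - l x y).
Proof. by move=> bk bl; apply: bmeas2D => //; exact: bmeas2N. Qed.

Lemma bmeas2_fst k : bmeas1 k -> bmeas2 (fun x _ => k x).
Proof.
move=> [mk [M kM]]; split; first exact: (measurableT_comp mk measurable_fst).
by exists M => x y bx bY; exact: kM.
Qed.

Lemma bmeas2_snd k : bmeas1 k -> bmeas2 (fun _ y => k y).
Proof.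
move=> [mk [M kM]]; split; first exact: (measurableT_comp mk measurable_snd).
by exists M => x y bx bY; exact: kM.
Qed.

Lemma bmeas2_swap h : bmeas2 h -> bmeas2 (fun x y => h y x).
Proof.
move=> [mh [M hM]]; split; last by exists M => x y bx bY; exact: hM.
exact: (measurableT_comp mh (@measurable_swap _ _ _ _)).
Qed.

Lemma bmeas2_row h x : bmeas2 h -> box x -> bmeas1 (h x).
Proof.
move=> [mh [M hM]] bx; split; last by exists M => y bY; exact: hM.
have := measurable_fun_pair2 x mh; rewrite /= clamp_id//.
Qed.

Lemma bmeas2_col h y : bmeas2 h -> box y -> bmeas1 (h ^~ y).
Proof. by move=> bh bY; exact: (bmeas2_row (bmeas2_swap bh)). Qed.

Lemma bmeas2_integrable m m' h : bmeas2 h ->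
  (m \x m')%E.-integrable setT
    (fun z => (h (clamp vbar z.1) (clamp vbar z.2))%:E).
Proof.
move=> [mh [M hM]].
apply: (@measurable_bounded_integrable _ _ _ _
  (fun z => h (clamp vbar z.1) (clamp vbar z.2))) => //.
- have : ((m \x m') setT)%E = 1%E.
    rewrite -setXTT product_measure1E// -[LHS]/(m setT * m' setT)%E.
    by rewrite !probability_setT mule1.
  by move=> H; rewrite [X in (X < _)%E]H ltry.
- exists M; split; first exact: num_real.
  move=> N MN x _ /=; apply: (le_trans (hM _ _ _ _) (ltW MN)); exact: clamp_box.
Qed.

Lemma bmeas1_boxint m h : bmeas2 h -> bmeas1 (fun x => boxint m (h x)).
Proof.
move=> bh; have [_ [M hM]] := bh; split.
  have := measurable_fubini_F (bmeas2_integrable m m bh).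
  have mfine : measurable_fun setT (@fine R) by [].
  exact: (measurableT_comp mfine).
exists M => x bx; have bhx := bmeas2_row bh bx; rewrite ler_norml.
rewrite -[in X in X && _](boxint_cst m (- M)) -[in X in _ && X](boxint_cst m M).
by apply/andP; split; apply: le_boxint => //; try exact: bmeas1_cst;
  move=> y bY; have := hM _ _ bx bY; rewrite ler_norml => /andP[].
Qed.

Lemma boxint_swap m m' h : bmeas2 h ->
  boxint m (fun x => boxint m' (h x)) = boxint m' (fun y => boxint m (h ^~ y)).
Proof.
move=> bh; apply: EFin_inj.
rewrite (EFin_boxint _ (bmeas1_boxint m' bh)).
rewrite (EFin_boxint _ (bmeas1_boxint m (bmeas2_swap bh))).
transitivity (\int[m]_x \int[m']_y (h (clamp vbar x) (clamp vbar y))%:E)%E.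
  apply: eq_integral => x _; rewrite EFin_boxint//.
  by apply: bmeas2_row => //; exact: clamp_box.
have /= -> := Fubini (bmeas2_integrable m m' bh); apply: eq_integral => y _; rewrite EFin_boxint//.
by apply: (bmeas2_row (bmeas2_swap bh)) => //; exact: clamp_box.
Qed.

(** * One-round functions of mean zero *)

Section Centered.
Variables (F G : probability R R).

Definition centered (h : R -> R -> R) : Prop :=
  bmeas2 h /\ boxint F (fun v => boxint G (h v)) = 0.

Lemma centered0 : centered (fun _ _ => 0).
Proof. by split; [exact: bmeas2_cst|rewrite !boxint_cst]. Qed.

Lemma centeredD h l : centered h -> centered l ->
  centered (fun v p => h v p + l v p).
Proof.
move=> [bh h0] [bl l0]; split; first exact: bmeas2D.
rewrite (@eq_boxint _ _ (fun v => boxint G (h v) + boxint G (l v))); last first.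
  by move=> v bv; rewrite boxintD//; exact: bmeas2_row.
by rewrite boxintD ?h0 ?l0 ?addr0//; apply: bmeas1_boxint.
Qed.

Lemma centeredZ c h : centered h -> centered (fun v p => c * h v p).
Proof.
move=> [bh h0]; split; first exact: bmeas2M (bmeas2_cst c) bh.
rewrite (@eq_boxint _ _ (fun v => c * boxint G (h v))); last first.
  by move=> v bv; rewrite boxintZ//; exact: bmeas2_row.
by rewrite boxintZ ?h0 ?mulr0//; apply: bmeas1_boxint.
Qed.

Lemma eq_centered h l : (forall v p, h v p = l v p) -> centered h -> centered l.
Proof. by move=> hl; rewrite (_ : h = l)//; apply/funext => v; apply/funext. Qed.

Lemma centeredB h l : centered h -> centered l ->
  centered (fun v p => h v p - l v p).
Proof.
move=> ch cl; apply: eq_centered (centeredD ch (centeredZ (-1) cl)) => v p; ring.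
Qed.

Lemma centered_fst k : bmeas1 k -> centered (fun v _ => k v - boxint F k).
Proof.
move=> bk; split; first exact: bmeas2B (bmeas2_fst bk) (bmeas2_cst _).
rewrite (@eq_boxint _ _ (fun v => k v - boxint F k)); last first.
  by move=> v bv; rewrite boxint_cst.
by rewrite boxintB ?boxint_cst ?subrr//; exact: bmeas1_cst.
Qed.

(** The factor [y] may depend on the value but not on the bid, like a decision taken after seeing
    [v_t] and before seeing [p_t]. *)
Lemma centered_snd y h : bmeas1 y -> bmeas2 h ->
  centered (fun v p => y v * (h v p - boxint G (h v))).
Proof.
move=> bY bh; split.
  apply: bmeas2M (bmeas2_fst bY) _; apply: bmeas2B => //.
  by apply: bmeas2_fst; exact: bmeas1_boxint.
rewrite (@eq_boxint _ _ (fun=> 0)) ?boxint_cst// => v bv.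
have bhv := bmeas2_row bh bv.
rewrite boxintZ ?boxintB ?boxint_cst ?subrr ?mulr0//; try exact: bmeas1_cst.
exact: bmeas1B bhv (bmeas1_cst _).
Qed.

(** The bid arriving together with [v] is tested against an independent value [u]; after exchanging
    the integrals, the integral over the bid vanishes for each [u]. *)
Lemma centered_cross y M h : bmeas1 y -> bmeas1 M -> bmeas2 h ->
  centered (fun v p => y v *
    boxint F (fun u => M u * (h u p - boxint G (h u)))).
Proof.
move=> bY bM bh.
have bg : bmeas2 (fun u p => M u * (h u p - boxint G (h u))).
  apply: bmeas2M (bmeas2_fst bM) _; apply: bmeas2B => //.
  by apply: bmeas2_fst; exact: bmeas1_boxint.
have bk := bmeas1_boxint F (bmeas2_swap bg).
split; first exact: bmeas2M (bmeas2_fst bY) (bmeas2_snd bk).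
rewrite (@eq_boxint _ _ (fun=> 0)) ?boxint_cst// => v bv.
rewrite boxintZ// -boxint_swap// (@eq_boxint _ _ (fun=> 0)) ?boxint_cst ?mulr0// => u bu.
have bhu := bmeas2_row bh bu.
rewrite boxintZ ?boxintB ?boxint_cst ?subrr ?mulr0//; try exact: bmeas1_cst.
exact: bmeas1B bhu (bmeas1_cst _).
Qed.

End Centered.
End BoxIntegral.

(** * Iterated expectations and martingales *)

Section Expectation.
Context {R : realType}.
Variable vbar : R.
Hypothesis vbar_gt0 : 0 < vbar.
Variables (F G : probability R R).
Hypotheses (F1 : F `[0, vbar]%classic = 1%E) (G1 : G `[0, vbar]%classic = 1%E).
Notation box := (inbox vbar).
Notation path := (nat -> R).

Definition inboxes (v : path) : Prop := forall t, box (v t).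

Definition upd (a : path) (t : nat) (x : R) : path :=
  fun i => if i == t then x else a i.

Lemma inboxes_scons a x : inboxes a -> box x -> inboxes (scons x a).
Proof. by move=> ba bx [|i] //=; exact: ba. Qed.

Lemma inbox0 : box 0.
Proof. by rewrite /inbox lexx ltW. Qed.

Lemma upd_eq a t x : upd a t x t = x.
Proof. by rewrite /upd eqxx. Qed.

Lemma upd_lt a t x i : (i < t)%N -> upd a t x i = a i.
Proof. by rewrite /upd; case: eqP => // ->; rewrite ltnn. Qed.

Lemma scons_upd x a t y : scons x (upd a t y) = upd (scons x a) t.+1 y.
Proof. by apply/funext => -[|i]. Qed.

Lemma expect_vp_ge0 n (f : path -> path -> \bar R) :
  (forall v p, inboxes v -> inboxes p -> 0 <= f v p)%E ->
  (0 <= expect_vp F G n f)%E.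
Proof.
elim: n f => [f f0|n IH f f0] /=; first by apply: f0 => t; exact: inbox0.
have int_ge0 (m : probability R R) (k : R -> \bar R) :
    m `[0, vbar]%classic = 1%E -> (forall x, box x -> 0 <= k x)%E ->
    (0 <= \int[m]_x k x)%E.
  move=> m1 k0; rewrite -[leLHS](@integral0 _ _ _ m setT).
  by apply: (le_integral_box m1).
apply: (int_ge0) => // v0 bv; apply: (int_ge0) => // p0 bp.
by apply: IH => v p bv' bp'; apply: f0; exact: inboxes_scons.
Qed.

Definition adapted (D : nat -> path -> path -> R) : Prop :=
  forall t v p v' p', (forall i, (i <= t)%N -> v i = v' i) ->
    (forall i, (i <= t)%N -> p i = p' i) -> D t v p = D t v' p'.

(** Conditional mean zero, expressed without filtrations: the past is frozen at arbitrary box points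
    [a], [b] and only round [t] is integrated. It is paired with [adapted], under which [D t] is
    determined by the rounds up to [t]. *)
Definition martingale_diff T (D : nat -> path -> path -> R) : Prop :=
  forall t a b, (t < T)%N -> inboxes a -> inboxes b ->
    centered vbar F G (fun v0 p0 => D t (upd a t v0) (upd b t p0)).

(* Peels off the first round: once [v0], [p0] are fixed, the remaining rounds
   see a martingale with initial value [C + D 0]. *)
Lemma expect_vp_lb T (f : path -> path -> R) C D :
  (forall v p, inboxes v -> inboxes p -> 0 <= f v p) ->
  adapted D -> martingale_diff T D ->
  (forall v p, inboxes v -> inboxes p -> C + \sum_(t < T) D t v p <= f v p) ->
  (C%:E <= expect_vp F G T (fun v p => (f v p)%:E))%E.
Proof.
elim: T f C D => [|T IH] f C D f0 aD mD Df /=.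
  have b0 : inboxes (fun=> 0) by move=> t; exact: inbox0.
  by rewrite lee_fin; have := Df _ _ b0 b0; rewrite big_ord0 addr0.
pose z : path := fun=> 0.
have bz : inboxes z by move=> t; exact: inbox0.
pose D0 v0 p0 := D 0%N (upd z 0%N v0) (upd z 0%N p0).
have [bD0 ED0] : centered vbar F G D0 by exact: mD.
(* [C] is rewritten as the mean of [C + D0], so that the comparison can be made under the integral
   signs, for each [v0] and [p0]. *)
have {1}-> : C = boxint vbar F (fun v => C + boxint vbar G (D0 v)).
  rewrite boxintD ?boxint_cst ?ED0 ?addr0//; first exact: bmeas1_cst.
  exact: bmeas1_boxint.
have E0 v0 p0 : box v0 -> box p0 -> (0 <= expect_vp F G T
    (fun v p => (f (scons v0 v) (scons p0 p))%:E))%E.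
  move=> bv0 bp0; apply: expect_vp_ge0 => v p bv bp.
  by rewrite lee_fin; apply: f0; exact: inboxes_scons.
apply: boxint_le_integral => //.
- by apply: bmeas1D; [exact: bmeas1_cst|exact: bmeas1_boxint].
- move=> v0 bv0; rewrite -[leLHS](@integral0 _ _ _ G setT).
  by apply: (le_integral_box G1) => // p0 bp0; exact: E0.
move=> v0 bv0.
have bDv := bmeas2_row bD0 bv0.
rewrite -[X in X + _](boxint_cst vbar G) -boxintD//; last exact: bmeas1_cst.
apply: boxint_le_integral => //.
- by apply: bmeas1D => //; exact: bmeas1_cst.
- by move=> p0 bp0; exact: E0.
move=> p0 bp0; apply: (IH (fun v p => f (scons v0 v) (scons p0 p)) _
  (fun t v p => D t.+1 (scons v0 v) (scons p0 p))).
- by move=> v p bv bp; apply: f0; exact: inboxes_scons.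
- by move=> t v p v' p' vv' pp'; apply: aD => -[|i] //= it; [exact: vv'|exact: pp'].
- move=> t a b tT ba bb.
  apply: eq_centered (mD t.+1 (scons v0 a) (scons p0 b) _ _ _) => //.
  + by move=> v p; rewrite !scons_upd.
  + exact: inboxes_scons.
  + exact: inboxes_scons.
- move=> v p bv bp; apply: le_trans (Df _ _ (inboxes_scons bv bv0) (inboxes_scons bp bp0)).
  rewrite big_ord_recl addrA lerD2r lerD2l /D0.
  by rewrite (aD 0%N _ _ (scons v0 v) (scons p0 p))// => -[].
Qed.

Lemma expect_vp_ub T (f : path -> path -> R) C h :
  bmeas2 vbar h ->
  (forall v p, inboxes v -> inboxes p -> 0 <= f v p) ->
  (forall v p, inboxes v -> inboxes p ->
     f v p <= C + \sum_(t < T) h (v t) (p t)) ->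
  (expect_vp F G T (fun v p => (f v p)%:E) <=
   (C + T%:R * boxint vbar F (fun v => boxint vbar G (h v)))%:E)%E.
Proof.
move=> bh; set E := boxint _ _ _.
elim: T f C => [|T IH] f C f0 fh /=.
  have b0 : inboxes (fun=> 0) by move=> t; exact: inbox0.
  by rewrite lee_fin mul0r; have := fh _ _ b0 b0; rewrite big_ord0.
have E0 v0 p0 : box v0 -> box p0 -> (0 <= expect_vp F G T
    (fun v p => (f (scons v0 v) (scons p0 p))%:E))%E.
  move=> bv0 bp0; apply: expect_vp_ge0 => v p bv bp.
  by rewrite lee_fin; apply: f0; exact: inboxes_scons.
have -> : C + T.+1%:R * E =
    boxint vbar F (fun v => (C + T%:R * E) + boxint vbar G (h v)).
  rewrite boxintD ?boxint_cst -?/E//; [|exact: bmeas1_cst|exact: bmeas1_boxint].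
  by rewrite -natr1 mulrDl mul1r addrA.
apply: integral_le_boxint => //.
- by apply: bmeas1D; [exact: bmeas1_cst|exact: bmeas1_boxint].
- move=> v0 bv0; rewrite -[leLHS](@integral0 _ _ _ G setT).
  by apply: (le_integral_box G1) => // p0 bp0; exact: E0.
move=> v0 bv0.
have bDv := bmeas2_row bh bv0.
rewrite -[X in X + boxint _ _ _](boxint_cst vbar G) -boxintD//; last exact: bmeas1_cst.
apply: integral_le_boxint => //.
- by apply: bmeas1D => //; exact: bmeas1_cst.
- by move=> p0 bp0; exact: E0.
move=> p0 bp0; rewrite addrAC.
apply: (IH (fun v p => f (scons v0 v) (scons p0 p))).
- by move=> v p bv bp; apply: f0; exact: inboxes_scons.
- move=> v p bv bp; apply: le_trans (fh _ _ (inboxes_scons bv bv0) (inboxes_scons bp bp0)) _.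
  by rewrite big_ord_recl addrA.
Qed.

Lemma expect_vpg_cst n (f : path -> path -> \bar R) :
  expect_vpg F G n (fun v p _ => f v p) = expect_vp F G n f.
Proof.
elim: n f => //= n IH f; apply: eq_integral => v0 _; apply: eq_integral => p0 _.
rewrite IH integral_cst// [X in (_ * X)%E](_ : _ = 1%E) ?mule1//.
by rewrite /= lebesgue_measure_itv/= lte_fin ltr01 oppr0 adde0.
Qed.

Let le_integral_unit (k l : R -> \bar R) :
  (forall x, 0 <= k x)%E -> (forall x, k x <= l x)%E ->
  (\int[lebesgue_measure]_(x in `[0%R, 1%R]) k x <=
   \int[lebesgue_measure]_(x in `[0%R, 1%R]) l x)%E.
Proof.
move=> k0 kl; rewrite integral_mkcond [leRHS]integral_mkcond.
apply: (@le_integral_nonmeasurable _ _ _ _ setT) => //.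
- by rewrite setCT measure0.
- by move=> x _; rewrite /patch; case: ifP.
- by move=> x _; rewrite /patch; case: ifP.
Qed.

Lemma expect_vpg_ge0 n (f : path -> path -> path -> \bar R) :
  (forall v p g, inboxes v -> inboxes p -> 0 <= f v p g)%E ->
  (0 <= expect_vpg F G n f)%E.
Proof.
elim: n f => [f f0|n IH f f0] /=; first by apply: f0 => t; exact: inbox0.
rewrite -[leLHS](@integral0 _ _ _ F setT).
apply: (le_integral_box F1) => // v0 bv0.
rewrite -[leLHS](@integral0 _ _ _ G setT).
apply: (le_integral_box G1) => // p0 bp0.
by apply: integral_ge0 => g0 _; apply: IH => v p g bv bp; apply: f0;
  exact: inboxes_scons.
Qed.

Lemma le_expect_vpg n (f h : path -> path -> path -> \bar R) :
  (forall v p g, inboxes v -> inboxes p -> 0 <= f v p g)%E ->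
  (forall v p g, inboxes v -> inboxes p -> f v p g <= h v p g)%E ->
  (expect_vpg F G n f <= expect_vpg F G n h)%E.
Proof.
elim: n f h => [|n IH] f h f0 fh /=; first by apply: fh => t; exact: inbox0.
have E0 v0 p0 g0 : box v0 -> box p0 -> (0 <= expect_vpg F G n
    (fun v p g => f (scons v0 v) (scons p0 p) (scons g0 g)))%E.
  move=> bv0 bp0; apply: expect_vpg_ge0 => v p g bv bp.
  by apply: f0; exact: inboxes_scons.
have I0 v0 p0 : box v0 -> box p0 ->
    (0 <= \int[lebesgue_measure]_(g0 in `[0%R, 1%R]) expect_vpg F G n
      (fun v p g => f (scons v0 v) (scons p0 p) (scons g0 g)))%E.
  by move=> bv0 bp0; apply: integral_ge0 => g0 _; exact: E0.
apply: (le_integral_box F1) => v0 bv0.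
  rewrite -[leLHS](@integral0 _ _ _ G setT).
  by apply: (le_integral_box G1) => // p0 bp0; exact: I0.
apply: (le_integral_box G1) => p0 bp0; first exact: I0.
apply: le_integral_unit => g0; first exact: E0.
by apply: IH => v p g bv bp; [apply: f0|apply: fh]; exact: inboxes_scons.
Qed.

End Expectation.

(** * Adaptive pacing *)

Section RewardCost.
Context {R : realType}.
Variable vbar : R.
Hypothesis vbar_gt0 : 0 < vbar.
Variables (F G : probability R R).
Notation box := (inbox vbar).
Notation path := (nat -> R).

Definition mean (h : R -> R -> R) : R :=
  boxint vbar F (fun v => boxint vbar G (h v)).

Lemma rwd_ge0 (v p : R) : 0 <= rwd v p.
Proof. by rewrite /rwd le_max lexx orbT. Qed.

Lemma rwd_box (v p : R) : box v -> box p -> 0 <= rwd v p <= v.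
Proof.
move=> /andP[v0 vv] /andP[p0 pv]; rewrite rwd_ge0 /rwd ge_max v0 andbT; lra.
Qed.

Lemma cost_box (v p : R) : box v -> box p -> 0 <= cost v p <= v.
Proof.
by move=> /andP[v0 vv] /andP[p0 pv]; rewrite /cost; case: ifP => [->|_];
  rewrite ?p0 ?lexx ?v0.
Qed.

Lemma bmeas2_rwd : bmeas2 vbar (@rwd R).
Proof.
split.
  apply: measurable_maxr => //; apply: measurable_funB.
    exact: (measurableT_comp (measurable_clamp _) measurable_fst).
  exact: (measurableT_comp (measurable_clamp _) measurable_snd).
exists vbar => v p bv bp; have /andP[r0 rv] := rwd_box bv bp.
by rewrite ger0_norm//; move: bv => /andP[_]; exact: le_trans.
Qed.

Lemma bmeas2_cost : bmeas2 vbar (@cost R).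
Proof.
have m1 := measurableT_comp (measurable_clamp vbar) (@measurable_fst _ _ R R).
have m2 := measurableT_comp (measurable_clamp vbar) (@measurable_snd _ _ R R).
split.
  by apply: measurable_fun_ifT => //; exact: measurable_fun_ler.
exists vbar => v p bv bp; have /andP[r0 rv] := cost_box bv bp.
by rewrite ger0_norm//; move: bv => /andP[_]; exact: le_trans.
Qed.

Lemma mean_box h : bmeas2 vbar h ->
  (forall v p, box v -> box p -> 0 <= h v p <= v) -> 0 <= mean h <= vbar.
Proof.
move=> bh hb.
have hv v : box v -> 0 <= boxint vbar G (h v) <= vbar.
  move=> bv; have bhv := bmeas2_row bh bv; rewrite boxint_ge0 => [/=||p bp] //.
    rewrite -[leRHS](boxint_cst vbar G); apply: le_boxint => //.
      exact: bmeas1_cst.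
    move=> p bp; have /andP[_] := hb _ _ bv bp; move: bv => /andP[_] ? ?.
    exact: le_trans _ (_ : v <= vbar).
  by have /andP[] := hb _ _ bv bp.
rewrite /mean boxint_ge0 => [/=||v bv] //; last by have /andP[] := hv _ bv.
rewrite -[leRHS](boxint_cst vbar F); apply: le_boxint => //.
- exact: bmeas1_boxint.
- exact: bmeas1_cst.
- by move=> v bv; have /andP[] := hv _ bv.
Qed.

Lemma centered_mean h : bmeas2 vbar h ->
  centered vbar F G (fun v p => h v p - mean h).
Proof.
move=> bh.
have c1 := centered_snd vbar_gt0 F G (bmeas1_cst vbar 1) bh.
have c2 := centered_fst vbar_gt0 F G (bmeas1_boxint vbar_gt0 G bh).
apply: eq_centered (centeredD vbar_gt0 c1 c2) => v p; rewrite /mean; ring.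
Qed.

Lemma E_cost : F `[0, vbar]%classic = 1%E -> G `[0, vbar]%classic = 1%E ->
  (\int[F]_v \int[G]_p (cost v p)%:E = (mean (@cost R))%:E)%E.
Proof.
move=> F1 G1.
have c0 v p : box v -> box p -> (0 <= (cost v p)%:E)%E.
  by move=> bv bp; rewrite lee_fin; have /andP[] := cost_box bv bp.
have ic0 v : box v -> (0 <= \int[G]_p (cost v p)%:E)%E.
  move=> bv; rewrite -[leLHS](@integral0 _ _ _ G setT).
  by apply: (le_integral_box G1) => // p bp; exact: c0.
have bc := bmeas2_cost; have bc' := bmeas1_boxint vbar_gt0 G bc.
apply/eqP; rewrite eq_le; apply/andP; split.
  apply: integral_le_boxint => // v bv.
  by apply: integral_le_boxint => //; [exact: bmeas2_row|move=> p; exact: c0].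
apply: boxint_le_integral => // v bv.
by apply: boxint_le_integral => //; [exact: bmeas2_row|move=> p; exact: c0].
Qed.

(** The price of overspending: exceeding the rate [rho] by [K] in total costs at most [K / rho]
    rounds, each worth at most [vbar]. Hence the factor [vbar / rho] in every loss below. *)
Lemma lost_rounds_le (rho n r K : R) : 0 < rho -> 0 <= n -> 0 <= r <= vbar ->
  rho * n <= K -> n * r <= vbar / rho * K.
Proof.
move=> rho0 n0 /andP[r0 rv] nK; apply: (@le_trans _ _ (n * vbar)).
  by rewrite ler_wpM2l.
have -> : n * vbar = vbar / rho * (rho * n) by field; rewrite gt_eqF.
by rewrite ler_wpM2l// divr_ge0// ltW.
Qed.

End RewardCost.

(** * The pacing multiplier: regret and spending *)

Section Pacing.
Context {R : realType}.
Variables (vbar rho : R) (F G : probability R R).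
Hypotheses (vbar_gt0 : 0 < vbar) (rho_gt0 : 0 < rho) (rho_le : rho <= vbar).
Hypotheses (F1 : F `[0, vbar]%classic = 1%E) (G1 : G `[0, vbar]%classic = 1%E).
Variables (e mubar mu1 : R).
Hypotheses (e_gt0 : 0 < e) (e_le : e * vbar <= 1).
Hypotheses (mubar_ge : vbar / rho <= mubar) (mu1_box : 0 <= mu1 <= mubar).
Notation box := (inbox vbar).
Notation path := (nat -> R).
Let rbar := mean vbar F G (@rwd R).
Let cbar := mean vbar F G (@cost R).
Hypothesis cbar_le : cbar <= rho.

Definition pac_win (mu B v p : R) : bool := p <= Num.min (v / (1 + mu)) B.

Definition pac_mu (mu z : R) : R :=
  Num.min (Num.max (mu - e * (rho - z)) 0) mubar.

Lemma pac_win_box (mu B v p : R) : 0 <= mu -> box v -> 0 <= p ->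
  pac_win mu B v p -> p <= v /\ p * (1 + mu) <= v.
Proof.
move=> mu0 /andP[v0 _] p0; rewrite /pac_win le_min ler_pdivlMr; last by lra.
move=> /andP[pv _]; split => //; nra.
Qed.

(** The bid [v / (1 + mu)] wins exactly when [v - p - mu * p >= 0], so it picks the larger of this
    Lagrangian and [0], while [rwd - mu * cost] is always one of the two. The cap by [B] does not
    interfere since [p <= vbar <= B]. *)
Lemma pac_gain_ge (mu B v p : R) : 0 <= mu -> box v -> box p -> vbar <= B ->
  rwd v p - mu * cost v p + mu * (if pac_win mu B v p then p else 0)
    <= (if pac_win mu B v p then v - p else 0).
Proof.
move=> mu0 bv bp vB; have /andP[p0 pv] := bp; have /andP[v0 vv] := bv.
have [w|nw] := boolP (pac_win mu B v p).
  have [pv' _] := pac_win_box mu0 bv p0 w.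
  by rewrite /rwd /cost pv' max_l; lra.
have lt : v < p * (1 + mu).
  move: nw; rewrite /pac_win le_min negb_and -!ltNge ltr_pdivrMr; last by lra.
  by move=> /orP[//|]; lra.
rewrite /rwd /cost; case: ifP => [pv'|/negbT]; last rewrite -ltNge => pv'.
  by rewrite max_l; nra.
by rewrite max_r; lra.
Qed.

(** The projection never cuts at [mubar]: the multiplier rises only if [z > rho], and then
    [z * (1 + mu) <= v] forces [1 + mu <= vbar / rho <= mubar], while the step is at most
    [e * vbar <= 1]. Only the cut at [0] remains. It can only raise the multiplier, which gives the
    lower bound used for spending, and brings it closer to the comparator [0], which gives the bound
    on squares. *)
Lemma pac_mu_step (mu z v : R) : 0 <= mu <= mubar -> box v -> 0 <= z ->
  z * (1 + mu) <= v ->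
  [/\ 0 <= pac_mu mu z <= mubar, mu - e * (rho - z) <= pac_mu mu z &
      pac_mu mu z ^+ 2 <= mu ^+ 2 - 2 * e * (mu * (rho - z)) + e ^+ 2 * vbar ^+ 2].
Proof.
move=> /andP[mu0 mum] /andP[v0 vv] z0 zv.
have mubar0 : 0 <= mubar by lra.
have zvb : z <= vbar.
  have : 0 <= z * mu by rewrite mulr_ge0.
  lra.
have up : mu - e * (rho - z) <= mubar.
  have [zr|rz] := leP z rho.
    have : 0 <= e * (rho - z) by rewrite mulr_ge0 ?subr_ge0// ltW.
    lra.
  have h : rho * (1 + mu) <= vbar.
    have : rho * (1 + mu) <= z * (1 + mu) by rewrite ler_wpM2r ?(ltW rz)//; lra.
    lra.
  have h1 : 1 + mu <= vbar / rho by rewrite ler_pdivlMr// mulrC.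
  have h2 : e * (z - rho) <= e * vbar by rewrite ler_wpM2l ?(ltW e_gt0)//; move: rho_gt0; lra.
  move: mubar_ge e_le; lra.
rewrite /pac_mu; split.
- by rewrite le_min mubar0 le_max lexx orbT ge_min lexx orbT.
- by rewrite le_min up andbT le_max lexx.
have : (Num.min (Num.max (mu - e * (rho - z)) 0) mubar) ^+ 2
    <= (mu - e * (rho - z)) ^+ 2.
  rewrite min_l ?ge_max ?up//.
  have [h|h] := leP (mu - e * (rho - z)) 0; last by rewrite lexx.
  by rewrite expr0n sqr_ge0.
move=> /le_trans; apply.
have : (rho - z) ^+ 2 <= vbar ^+ 2.
  have : 0 <= (vbar - (rho - z)) * (vbar + (rho - z)).
    by rewrite mulr_ge0//; move: rho_gt0 rho_le; lra.
  lra.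
move=> /(ler_wpM2l (sqr_ge0 e)); lra.
Qed.

Lemma pac_gain_box T v p : inboxes vbar v -> inboxes vbar p -> forall t,
  0 <= pac_gain e mubar mu1 rho (rho * T%:R) v p t <= rwd (v t) (p t).
Proof.
move=> bv bp t.
have mubar0 : 0 <= mubar by move: mu1_box; lra.
have mu0 s : 0 <= (pac_state e mubar mu1 rho (rho * T%:R) v p s).1.
  elim: s => [|s IH] /=; first by move: mu1_box => /andP[].
  by case: pac_state => mu B /=; rewrite le_min mubar0 le_max lexx orbT.
rewrite /pac_gain; case: pac_state (mu0 t) => mu B /= mu_ge0.
rewrite -/(pac_win mu B (v t) (p t)); case: ifP => [W|_]; last first.
  by rewrite lexx rwd_ge0.
have [pv _] := pac_win_box mu_ge0 (bv t) (proj1 (andP (bp t))) W.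
by rewrite /rwd le_max lexx subr_ge0 pv.
Qed.

(** Noise of the one-round Lagrangian at the current multiplier. It is switched off once the budget
    is below [vbar], where [pac_gain_ge] no longer applies. *)
Definition pac_mart T (t : nat) (v p : path) : R :=
  let: (mu, B) := pac_state e mubar mu1 rho (rho * T%:R) v p t in
  if vbar <= B then
    (rwd (v t) (p t) - rbar) - mu * (cost (v t) (p t) - cbar) else 0.

Lemma pac_state_prefix B0 t v p v' p' : (forall i, (i < t)%N -> v i = v' i) ->
  (forall i, (i < t)%N -> p i = p' i) ->
  pac_state e mubar mu1 rho B0 v p t = pac_state e mubar mu1 rho B0 v' p' t.
Proof.
elim: t => //= t IH vv pp.
by rewrite IH ?vv ?pp// => i it; [apply: vv|apply: pp]; exact: ltnW.
Qed.

Lemma pac_mart_adapted T : adapted (pac_mart T).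
Proof.
move=> t v p v' p' vv pp; rewrite /pac_mart vv// pp//.
by rewrite (@pac_state_prefix _ _ v p v' p')// => i it; [apply: vv|apply: pp];
  exact: ltnW.
Qed.

Lemma pac_mart_diff T : martingale_diff vbar F G T (pac_mart T).
Proof.
move=> t a b tT ba bb; rewrite /pac_mart.
have St x y : pac_state e mubar mu1 rho (rho * T%:R) (upd a t x) (upd b t y) t =
    pac_state e mubar mu1 rho (rho * T%:R) a b t.
  by apply: pac_state_prefix => i it; rewrite upd_lt.
case E : (pac_state e mubar mu1 rho (rho * T%:R) a b t) => [mu B].
have [vB|vB] := boolP (vbar <= B).
  apply: (@eq_centered _ _ _ _
      (fun v p => (rwd v p - rbar) - mu * (cost v p - cbar))).
    by move=> x y; rewrite St E vB !upd_eq.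
  apply: centeredB => //; first by apply: centered_mean => //; exact: bmeas2_rwd.
  by apply: centeredZ => //; apply: centered_mean => //; exact: bmeas2_cost.
apply: (@eq_centered _ _ _ _ (fun _ _ => 0)); last exact: centered0.
by move=> x y; rewrite St E (negbTE vB).
Qed.

(** The summands are the initial distance to the comparator [0], the accumulated squared gradients,
    and the rounds lost after the budget runs out. *)
Definition pac_loss (T : nat) : R :=
  mubar ^+ 2 / (2 * e) + T%:R * (e * vbar ^+ 2 / 2) +
  vbar / rho * (vbar + mubar / e).

Lemma pac_path T v p : vbar <= rho * T%:R -> inboxes vbar v -> inboxes vbar p ->
  (T%:R * rbar - pac_loss T) + \sum_(t < T) pac_mart T t v p
    <= pac_revenue e mubar mu1 rho T v p.
Proof.
move=> vT bv bp; rewrite /pac_revenue.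
set B0 := rho * T%:R; pose S t := pac_state e mubar mu1 rho B0 v p t.
pose V t := \sum_(s < t) pac_gain e mubar mu1 rho B0 v p s.
pose M t := \sum_(s < t) pac_mart T s v p.
have /andP[rb0 rbv] : 0 <= rbar <= vbar.
  by apply: mean_box => //; [exact: bmeas2_rwd|exact: rwd_box].
have ie0 : 0 < e^-1 by rewrite invr_gt0.
have ee : e^-1 * e = 1 by rewrite mulVf ?gt_eqF.
have reg_le x : - (mubar ^+ 2 / (2 * e)) <= - (e^-1 / 2 * (mu1 ^+ 2 - x ^+ 2)).
  have -> : mubar ^+ 2 / (2 * e) = e^-1 / 2 * mubar ^+ 2.
    by field; rewrite gt_eqF.
  rewrite lerN2 ler_wpM2l ?divr_ge0 ?(ltW ie0)//.
  have : mu1 ^+ 2 <= mubar ^+ 2.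
    by move: mu1_box => /andP[m0 m1]; rewrite ler_pXn2r ?nnegrE//; lra.
  by have := sqr_ge0 x; lra.
(* Two phases. While the budget is at least [vbar], the telescoped regret and spending bounds are
   carried along. From the first moment below [vbar], the final bound already holds, and it persists
   because gains are nonnegative and [pac_mart] vanishes. *)
have H t : (t <= T)%N -> [/\ 0 <= (S t).1 <= mubar, 0 <= (S t).2 &
  [/\ vbar <= (S t).2,
   t%:R * rbar + M t - e^-1 / 2 * (mu1 ^+ 2 - (S t).1 ^+ 2)
      - t%:R * (e * vbar ^+ 2 / 2) <= V t &
   B0 - (S t).2 <= rho * t%:R + e^-1 * ((S t).1 - mu1)] \/
   ((S t).2 < vbar /\ T%:R * rbar - pac_loss T + M t <= V t)].
  elim: t => [_|t IH tT].
    split=> //=; first by rewrite mulr_ge0// ltW.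
    left; split; [by []|rewrite /V /M !big_ord0; lra|by rewrite subrr; lra].
  have [mu0 B_ge0 dis] := IH (ltnW tT).
  have bvt := bv t; have bpt := bp t.
  have /andP[p0 pvb] := bpt; have /andP[v0 vvb] := bvt.
  pose mu := (S t).1; pose B := (S t).2.
  have St : pac_state e mubar mu1 rho B0 v p t = (mu, B) by rewrite /mu /B -surjective_pairing.
  pose w := pac_win mu B (v t) (p t).
  pose z := if w then p t else 0.
  have gE : pac_gain e mubar mu1 rho B0 v p t = if w then v t - p t else 0.
    by rewrite /pac_gain St.
  have SE : S t.+1 = (pac_mu mu z, B - z) by rewrite /S /= St.
  have VE : V t.+1 = V t + (if w then v t - p t else 0).
    by rewrite /V big_ord_recr /= gE.
  have ME : M t.+1 = M t + pac_mart T t v p by rewrite /M big_ord_recr.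
  have /andP[mu_ge0 mu_le] := mu0.
  have [z0 zv zB] : [/\ 0 <= z, z * (1 + mu) <= v t & z <= B].
    rewrite /z; case: ifP => [W|_]; last by rewrite mul0r.
    have [_ ->] := pac_win_box mu_ge0 bvt p0 W; split=> //.
    by move: W; rewrite /w /pac_win le_min => /andP[].
  have g0 : 0 <= (if w then v t - p t else 0).
    case: ifP => // W; have [? _] := pac_win_box mu_ge0 bvt p0 W; lra.
  have [mu0' mu_lb mu_sq] := pac_mu_step mu0 bvt z0 zv.
  rewrite SE /= VE ME; split=> //; first by lra.
  have martE : pac_mart T t v p = if vbar <= B then
    (rwd (v t) (p t) - rbar) - mu * (cost (v t) (p t) - cbar) else 0.
    by rewrite /pac_mart St.
  case: dis => [[vB HU HB]|[Bv HW]]; last first.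
    right; rewrite martE [vbar <= B]leNgt Bv /= addr0; split; first by lra.
    by apply: le_trans HW _; rewrite lerDl.
  have gge : rwd (v t) (p t) - mu * cost (v t) (p t) + mu * z
      <= (if w then v t - p t else 0) by exact: pac_gain_ge.
  rewrite vB in martE.
  have rsq : mu * (z - rho) >= e^-1 / 2 * (pac_mu mu z ^+ 2 - mu ^+ 2) - e * vbar ^+ 2 / 2.
    have h : 0 <= e^-1 / 2 by rewrite divr_ge0// ltW.
    have := ler_wpM2l h mu_sq.
    have -> : e^-1 / 2 * (mu ^+ 2 - 2 * e * (mu * (rho - z)) + e ^+ 2 * vbar ^+ 2) =
      e^-1 / 2 * mu ^+ 2 - (mu * (rho - z)) + e * vbar ^+ 2 / 2.
      by field; rewrite gt_eqF.
    lra.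
  (* The assumption on the expected cost enters here: it makes [mu * (rho - cbar)] nonnegative, so
     comparing with the multiplier [0] loses nothing. *)
  have mc : mu * cbar <= mu * rho by rewrite ler_wpM2l.
  have HU' : t.+1%:R * rbar + (M t + pac_mart T t v p)
      - e^-1 / 2 * (mu1 ^+ 2 - pac_mu mu z ^+ 2) - t.+1%:R * (e * vbar ^+ 2 / 2)
      <= V t + (if w then v t - p t else 0).
    rewrite martE -natr1 !mulrDl !mul1r.
    move: HU; rewrite -/mu; lra.
  have HB' : B0 - (B - z) <= rho * t.+1%:R + e^-1 * (pac_mu mu z - mu1).
    have := ler_wpM2l (ltW ie0) mu_lb.
    rewrite mulrBr mulrA ee mul1r -natr1 mulrDr mulr1.
    move: HB; rewrite -/mu -/B; lra.
  have [vB'|vB'] := leP vbar (B - z); first by left.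
  right; split=> //; apply: le_trans _ HU'.
  have nT : (t.+1%:R : R) <= T%:R by rewrite ler_nat.
  (* The budget has just dropped below [vbar], so [HB'] yields
     [rho * (T - t.+1) <= vbar + mubar / e]. *)
  have lost : (T%:R - t.+1%:R) * rbar <= vbar / rho * (vbar + mubar / e).
    apply: lost_rounds_le => //; [by rewrite subr_ge0|by rewrite rb0|].
    have : e^-1 * (pac_mu mu z - mu1) <= e^-1 * mubar.
      by rewrite ler_wpM2l ?(ltW ie0)//; move: mu1_box mu0'; lra.
    rewrite (mulrC mubar); move: HB'; rewrite /B0; lra.
  have := reg_le (pac_mu mu z).
  have : t.+1%:R * (e * vbar ^+ 2 / 2) <= T%:R * (e * vbar ^+ 2 / 2).
    by rewrite ler_wpM2r// divr_ge0// mulr_ge0 ?sqr_ge0// ltW.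
  rewrite /pac_loss; lra.
have [mu0 _ [[_ HU _]|[_ //]]] := H T (leqnn T).
apply: le_trans _ HU; have := reg_le (S T).1; rewrite -/(M T) /pac_loss.
have : 0 <= vbar / rho * (vbar + mubar / e).
  apply: mulr_ge0; first by rewrite divr_ge0// ltW.
  by rewrite addr_ge0 ?divr_ge0// ?(ltW vbar_gt0) ?(ltW e_gt0)//; move: mu1_box; lra.
lra.
Qed.

Lemma E_pac_ge T : vbar <= rho * T%:R ->
  ((T%:R * rbar - pac_loss T)%:E <= E_pac F G e mubar mu1 rho T)%E.
Proof.
move=> vT; apply: (expect_vp_lb vbar_gt0 F1 G1 _ (pac_mart_adapted T)
  (@pac_mart_diff T)) => v p bv bp; last exact: pac_path.
by apply: sumr_ge0 => t _; have /andP[] := pac_gain_box T bv bp t.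
Qed.

Lemma E_pac_le T : (E_pac F G e mubar mu1 rho T <= (T%:R * rbar)%:E)%E.
Proof.
rewrite -[X in (_ <= X%:E)%E]add0r; apply: expect_vp_ub => //.
- exact: bmeas2_rwd.
- by move=> v p bv bp; apply: sumr_ge0 => t _; have /andP[] := pac_gain_box T bv bp t.
- move=> v p bv bp; rewrite add0r; apply: ler_sum => t _.
  by have /andP[] := pac_gain_box T bv bp t.
Qed.

End Pacing.

(** * Throttling *)

Section Greedy.
Context {R : realType}.
Variables (vbar rho : R) (F G : probability R R) (info : bool).
Hypotheses (vbar_gt0 : 0 < vbar) (rho_gt0 : 0 < rho).
Hypotheses (F1 : F `[0, vbar]%classic = 1%E) (G1 : G `[0, vbar]%classic = 1%E).
Notation path := (nat -> R).
Let rbar := mean vbar F G (@rwd R).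
Let cbar := mean vbar F G (@cost R).
Hypothesis cbar_le : cbar <= rho.

(** Past spending is recovered from the history under both kinds of feedback, because the bid of an
    accepted round is always recorded and rejected rounds carry the factor 0. Keeping [vbar] in
    reserve makes one more payment affordable. *)
Definition greedy (B : R) : thr_strategy R := fun t a =>
  \sum_(i < t) (tnth a.1.1.2 i)%:R * cost (tnth a.1.1.1 i) (tnth a.1.2 i)
    <= B - vbar.

Lemma measurable_cost2 : measurable_fun setT (fun z : R * R => cost z.1 z.2).
Proof.
by apply: measurable_fun_ifT => //; exact: measurable_fun_ler.
Qed.

Lemma greedy_measurable B : thr_measurable (greedy B).
Proof.
move=> t; apply: measurable_fun_ler => //; apply: measurable_sum => i.
apply: measurable_funM.
  have mb : measurable_fun setT (fun b : bool => b%:R : R) by [].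
  apply: (measurableT_comp mb).
  apply: (measurableT_comp (measurable_tnth i)).
  apply: (measurableT_comp measurable_snd).
  exact: (measurableT_comp measurable_fst measurable_fst).
have mv : measurable_fun setT (fun a : history R t * (R * R) => tnth a.1.1.1 i).
  apply: (measurableT_comp (measurable_tnth i)).
  apply: (measurableT_comp measurable_fst).
  exact: (measurableT_comp measurable_fst measurable_fst).
have mp : measurable_fun setT (fun a : history R t * (R * R) => tnth a.1.2 i).
  apply: (measurableT_comp (measurable_tnth i)).
  exact: (measurableT_comp measurable_snd measurable_fst).
exact: (measurableT_comp measurable_cost2 (measurable_fun_pair mv mp)).
Qed.

Lemma size_thr_decs beta v p g t : size (thr_decs (R:=R) beta info v p g t) = t.
Proof. by elim: t => //= t IH; rewrite size_rcons IH. Qed.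

Lemma nth_thr_decs beta v p g t i : (i < t)%N ->
  nth false (thr_decs (R:=R) beta info v p g t) i = thr_x beta info v p g i.
Proof.
elim: t => // t IH; rewrite ltnS leq_eqVlt => /predU1P[->//|it].
by rewrite /= nth_rcons size_thr_decs it IH.
Qed.

Lemma thr_xE beta v p g t : thr_x (R:=R) beta info v p g t =
  beta t (mk_hist info t v p (thr_decs beta info v p g t), (v t, g t)).
Proof. by rewrite /thr_x /= nth_rcons size_thr_decs ltnn eqxx. Qed.

Section Run.
Variable B : R.
Notation x v p g t := (thr_x (greedy B) info v p g t).

Lemma greedy_xE v p g t : x v p g t =
  (\sum_(i < t) (x v p g i)%:R * cost (v i) (p i) <= B - vbar).
Proof.
rewrite thr_xE /greedy /=; congr (_ <= _); apply: eq_bigr => i _.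
rewrite !tnth_mktuple nth_thr_decs//.
by case: (x v p g i); rewrite ?orbT ?mul0r.
Qed.

(** The rule looks at neither the current value nor the internal randomness. Decisions are therefore
    predictable, which makes the noise terms centered and lets the integral over [g] be dropped. *)
Lemma greedy_x_prefix v p g v' p' g' t :
  (forall i, (i < t)%N -> v i = v' i) -> (forall i, (i < t)%N -> p i = p' i) ->
  x v p g t = x v' p' g' t.
Proof.
elim/ltn_ind: t => t IH vv pp; rewrite !greedy_xE; congr (_ <= _).
apply: eq_bigr => i _; rewrite (IH i) ?vv ?pp// => j ji; [apply: vv|apply: pp];
  exact: ltn_trans ji _.
Qed.

Lemma greedy_payment_le v p g : 0 <= B -> inboxes vbar v -> inboxes vbar p ->
  forall t, thr_payment t (greedy B) info v p g <= B.
Proof.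
move=> B_ge0 bv bp; elim=> [|t IH]; first by rewrite /thr_payment big_ord0.
rewrite /thr_payment big_ord_recr /=.
have [xt|_] := boolP (x v p g t); last by rewrite mul0r addr0.
move: (xt); rewrite greedy_xE mul1r => h.
have /andP[_ cv] := cost_box (bv t) (bp t); have /andP[_ vv] := bv t; lra.
Qed.
End Run.

Lemma greedy_admissible T : thr_admissible vbar (rho * T%:R) T (greedy (rho * T%:R)) info.
Proof.
move=> v p g bv bp _; apply: greedy_payment_le => //.
by rewrite mulr_ge0// ltW.
Qed.

Section Revenue.
Variable T : nat.
Hypothesis T_gt0 : (0 < T)%N.
Notation z := (fun _ : nat => 0 : R).
Notation x v p t := (thr_x (greedy (rho * T%:R)) info v p z t).
Let a := vbar * Num.sqrt (T%:R).

Definition excess (v p : path) (t : nat) : R :=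
  \sum_(i < t) (x v p i)%:R * (cost (v i) (p i) - cbar).

(** The second term is the cross term in the round-by-round expansion of [excess ^+ 2 / (2 * a)],
    priced at [vbar / rho]. *)
Definition greedy_mart (t : nat) (v p : path) : R :=
  (x v p t)%:R * (rwd (v t) (p t) - rbar) -
  (vbar / rho / a) * excess v p t * (x v p t)%:R * (cost (v t) (p t) - cbar).

Lemma greedy_mart_adapted : adapted greedy_mart.
Proof.
move=> t v p v' p' vv pp; rewrite /greedy_mart vv// pp//.
have xx i : (i <= t)%N -> x v p i = x v' p' i.
  move=> it; apply: greedy_x_prefix => j ji; [apply: vv|apply: pp];
    exact: leq_trans (ltnW ji) it.
rewrite xx//; congr (_ - _ * _ * _ * _); apply: eq_bigr => i _.
by rewrite xx ?(ltnW (ltn_ord i))// vv ?pp// ltnW.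
Qed.

Lemma greedy_mart_diff : martingale_diff vbar F G T greedy_mart.
Proof.
move=> t b c tT bb bc.
apply: (@eq_centered _ _ _ _ (fun v p => (x b c t)%:R * (rwd v p - rbar)
  - (vbar / rho / a * excess b c t * (x b c t)%:R) * (cost v p - cbar))); last first.
  by apply: centeredB => //; apply: centeredZ => //; apply: centered_mean => //;
    [exact: bmeas2_rwd|exact: bmeas2_cost].
move=> v p; rewrite /greedy_mart !upd_eq.
have xx i : (i <= t)%N -> x (upd b t v) (upd c t p) i = x b c i.
  by move=> it; apply: greedy_x_prefix => j ji; rewrite upd_lt//;
    exact: leq_trans ji it.
rewrite xx//; congr (_ - _ * _ * _ * _); apply: eq_bigr => i _.
by rewrite xx ?(ltnW (ltn_ord i))// !upd_lt.
Qed.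

Definition greedy_loss : R := vbar / rho * (vbar + a).

Lemma greedy_path v p : inboxes vbar v -> inboxes vbar p ->
  (T%:R * rbar - greedy_loss) + \sum_(t < T) greedy_mart t v p
    <= thr_revenue T (greedy (rho * T%:R)) info v p z.
Proof.
move=> bv bp.
have rb : 0 <= rbar <= vbar.
  by apply: mean_box => //; [exact: bmeas2_rwd|exact: rwd_box].
have cb : 0 <= cbar <= vbar.
  by apply: mean_box => //; [exact: bmeas2_cost|exact: cost_box].
have a0 : 0 < a by rewrite mulr_gt0// sqrtr_gt0 ltr0n.
pose N := excess v p T.
pose X : R := \sum_(t < T) (x v p t)%:R.
pose Q := \sum_(t < T) excess v p t * (x v p t)%:R * (cost (v t) (p t) - cbar).
have martE : \sum_(t < T) greedy_mart t v p =
    thr_revenue T (greedy (rho * T%:R)) info v p z - rbar * X - vbar / rho / a * Q.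
  rewrite /greedy_mart sumrB; congr (_ - _).
    rewrite /X mulr_sumr /thr_revenue -sumrB; apply: eq_bigr => t _; ring.
  rewrite /Q mulr_sumr; apply: eq_bigr => t _; ring.
have Nsq_n n : excess v p n ^+ 2 <= 2 * (\sum_(t < n) excess v p t *
    (x v p t)%:R * (cost (v t) (p t) - cbar)) + n%:R * vbar ^+ 2.
  elim: n => [|t IH]; first by rewrite /excess !big_ord0; lra.
  rewrite {1}/excess !big_ord_recr /= -/(excess v p t) -[t.+1%:R]natr1.
  set d := cost _ _ - _.
  have d2 : d ^+ 2 <= vbar ^+ 2.
    have /andP[c0 cv] := cost_box (bv t) (bp t); have /andP[_ vv] := bv t.
    have : 0 <= (vbar - d) * (vbar + d).
      by move: cb => /andP[cb0 cb1]; rewrite mulr_ge0// /d; lra.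
    lra.
  have vb2 := sqr_ge0 vbar.
  by case: (x v p t) => /=; lra.
have Nsq : N ^+ 2 <= 2 * Q + T%:R * vbar ^+ 2 by exact: Nsq_n.
have X_le : 0 <= T%:R - X.
  rewrite subr_ge0 -[T in T%:R]card_ord -sum1_card natr_sum /X.
  by apply: ler_sum => t _; case: (x v p t).
have lost : (T%:R - X) * rbar <= vbar / rho * (vbar + (a / 2 + N ^+ 2 / (2 * a))).
  apply: lost_rounds_le => //.
  have N_le : N <= a / 2 + N ^+ 2 / (2 * a).
    have -> : a / 2 + N ^+ 2 / (2 * a) = N + (a - N) ^+ 2 / (2 * a).
      by field; rewrite gt_eqF.
    by rewrite lerDl divr_ge0 ?sqr_ge0// mulr_ge0// ltW.
  have [/forallP all_x|] := boolP [forall t : 'I_T, x v p t].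
    have -> : X = T%:R.
      rewrite /X -[T in RHS]card_ord -sum1_card natr_sum.
      by apply: eq_bigr => t _; rewrite all_x.
    rewrite subrr mulr0 addr_ge0// ?(ltW vbar_gt0)// addr_ge0//.
      by rewrite divr_ge0// ltW.
    by rewrite divr_ge0 ?sqr_ge0// mulr_ge0// ltW.
  (* One rejection certifies that more than [rho * T - vbar] was spent by then, hence also by the
     end. Since accepted rounds cost [cbar <= rho] on average, the [T - X] lost rounds must show up
     in [N]. *)
  rewrite negb_forall => /existsP[t]; rewrite greedy_xE -ltNge => spent.
  have mono : \sum_(i < t) (x v p i)%:R * cost (v i) (p i) <=
      \sum_(i < T) (x v p i)%:R * cost (v i) (p i).
    rewrite -!(big_mkord xpredT (fun i => (x v p i)%:R * cost (v i) (p i))).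
    rewrite [leRHS](@big_cat_nat _ _ _ t)//= ?(ltnW (ltn_ord t))// lerDl.
    apply: sumr_ge0 => i _; rewrite mulr_ge0//.
    by have /andP[] := cost_box (bv i) (bp i).
  have NE : N = \sum_(i < T) (x v p i)%:R * cost (v i) (p i) - cbar * X.
    rewrite /N /excess /X mulr_sumr -sumrB; apply: eq_bigr => i _; ring.
  have cX : cbar * X <= rho * X.
    by rewrite ler_wpM2r// /X sumr_ge0.
  lra.
rewrite martE.
have aa : a ^+ 2 = T%:R * vbar ^+ 2.
  by rewrite /a exprMn sqr_sqrtr ?ler0n// mulrC.
have N2 : N ^+ 2 / (2 * a) <= Q / a + a / 2.
  have -> : Q / a + a / 2 = (2 * Q + a ^+ 2) / (2 * a) by field; rewrite gt_eqF.
  by rewrite aa ler_wpM2r// invr_ge0 mulr_ge0// ltW.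
have k0 : 0 <= vbar / rho by rewrite divr_ge0// ltW.
have : vbar / rho * (vbar + (a / 2 + N ^+ 2 / (2 * a))) <=
    vbar / rho * (vbar + a) + vbar / rho / a * Q.
  have -> : vbar / rho * (vbar + a) + vbar / rho / a * Q =
    vbar / rho * (vbar + a + Q / a) by field; rewrite !gt_eqF.
  by rewrite ler_wpM2l//; lra.
rewrite /greedy_loss; lra.
Qed.
End Revenue.

Lemma thr_revenue_ge0 T (beta : thr_strategy R) (v p g : path) : 0 <= thr_revenue T beta info v p g.
Proof. by apply: sumr_ge0 => t _; rewrite mulr_ge0// rwd_ge0. Qed.

Lemma E_thr_ge T : (0 < T)%N ->
  ((T%:R * rbar - greedy_loss T)%:E <= E_thr F G vbar rho T info)%E.
Proof.
move=> T0; pose z := fun _ : nat => 0 : R.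
pose f v p := thr_revenue T (greedy (rho * T%:R)) info v p z.
apply: (@le_trans _ _ (expect_vp F G T (fun v p => (f v p)%:E))).
  apply: (expect_vp_lb vbar_gt0 F1 G1 _ (greedy_mart_adapted T)
    (greedy_mart_diff (T:=T))) => v p bv bp; last exact: greedy_path.
  exact: thr_revenue_ge0.
apply: ereal_sup_ubound; exists (greedy (rho * T%:R)).
  by split; [exact: greedy_measurable|exact: greedy_admissible].
rewrite -expect_vpg_cst; congr (expect_vpg _ _ _ _).
apply/funext => v; apply/funext => p; apply/funext => g; congr _%:E.
by apply: eq_bigr => t _; rewrite (@greedy_x_prefix _ v p g v p z).
Qed.

Lemma E_thr_le T : (E_thr F G vbar rho T info <= (T%:R * rbar)%:E)%E.
Proof.
apply: ge_ereal_sup => _ [beta _ <-].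
pose f (v p : path) := \sum_(t < T) rwd (v t) (p t).
apply: (@le_trans _ _ (expect_vp F G T (fun v p => (f v p)%:E))).
  rewrite -expect_vpg_cst; apply: (le_expect_vpg vbar_gt0 F1 G1) => v p g bv bp.
    by rewrite lee_fin thr_revenue_ge0.
  rewrite lee_fin; apply: ler_sum => t _.
  by case: (thr_x _ _ _ _ _ _); rewrite ?mul1r// mul0r rwd_ge0.
rewrite -[X in (_ <= X%:E)%E]add0r; apply: expect_vp_ub => //.
- exact: bmeas2_rwd.
- by move=> v p bv bp; apply: sumr_ge0 => t _; exact: rwd_ge0.
- by move=> v p bv bp; rewrite add0r.
Qed.

End Greedy.

(** * Sums of inverse square roots *)

Section SqrtSums.
Context {R : realType}.
Notation s n := (Num.sqrt (n%:R : R)).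

Lemma sqr_sqrtn n : s n ^+ 2 = n%:R.
Proof. by rewrite sqr_sqrtr. Qed.

Lemma sqrtn_gt0 n : (0 < n)%N -> 0 < s n.
Proof. by move=> n0; rewrite sqrtr_gt0 ltr0n. Qed.

Lemma le_sqrtn m n : (m <= n)%N -> s m <= s n.
Proof. by move=> mn; rewrite ler_wsqrtr// ler_nat. Qed.

Lemma sqrtn_ge1 n : (0 < n)%N -> 1 <= s n.
Proof. by move=> n0; rewrite -[leLHS]sqrtr1 -[1]/(1%:R); exact: le_sqrtn. Qed.

Lemma sqrtSn_sqr n : s n.+1 ^+ 2 = s n ^+ 2 + 1.
Proof. by rewrite !sqr_sqrtn natr1. Qed.

Lemma sqrtSn_le n : s n.+1 <= s n + (s n.+1)^-1.
Proof.
have a0 := sqrtn_gt0 (ltn0Sn n); have b0 := sqrtr_ge0 (n%:R : R).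
rewrite -(ler_pM2r a0) mulrDl mulVf ?gt_eqF// -expr2 sqrtSn_sqr lerD2r.
by rewrite expr2 ler_wpM2l// le_sqrtn.
Qed.

Lemma sqrtSn_ge n : s n + (2 * s n.+1)^-1 <= s n.+1.
Proof.
have a0 := sqrtn_gt0 (ltn0Sn n); have b0 := sqrtr_ge0 (n%:R : R).
have a20 : 0 < 2 * s n.+1 by rewrite mulr_gt0.
rewrite -(ler_pM2r a20) mulrDl mulVf ?gt_eqF//.
have := sqrtSn_sqr n; have := sqr_ge0 (s n.+1 - s n); lra.
Qed.

Lemma inv_sqrtn_le n : (0 < n)%N -> (s n)^-1 <= 2 * (s n.+1)^-1.
Proof.
move=> n0; have a0 := sqrtn_gt0 (ltn0Sn n); have b0 := sqrtn_gt0 n0.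
have b1 := sqrtn_ge1 n0.
rewrite ler_pdivlMr// mulrC ler_pdivrMr//.
have h := sqrtSn_sqr n.
rewrite -(ler_pXn2r (ltn0Sn 1)) ?nnegrE ?mulr_ge0// ?ltW//.
have : 1 <= s n ^+ 2 by rewrite expr_ge1// ltW.
by rewrite h exprMn; lra.
Qed.

Lemma le_inv_sqrtS m n : (m <= n)%N -> (s n.+1)^-1 <= (s m.+1)^-1.
Proof. by move=> mn; rewrite lef_pV2 ?posrE ?sqrtn_gt0// le_sqrtn. Qed.

(** With [a = s n] and [b = s n.+1], [b - a = (a + b)^-1] turns the right side into
    [4 / (a * b * (a + b))], and [b ^+ 2 = a ^+ 2 + 1 <= 2 * a ^+ 2] gives
    [b * (a + b) <= 4 * a ^+ 2]. *)
Lemma inv_sqrtn_tele n : (0 < n)%N ->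
  (n%:R * s n)^-1 <= 4 * ((s n)^-1 - (s n.+1)^-1).
Proof.
move=> n0; have b0 := sqrtn_gt0 (ltn0Sn n); have a0 := sqrtn_gt0 n0.
have a1 := sqrtn_ge1 n0; have h := sqrtSn_sqr n; have an := sqr_sqrtn n.
rewrite -[X in X * _]an; set a := s n in a0 a1 h *; set b := s n.+1 in b0 h *.
have ab0 : 0 < a + b by lra.
have -> : 4 * (a^-1 - b^-1) = 4 / (a * b * (a + b)).
  have h1 : b - a = (a + b)^-1.
    apply: (mulIf (lt0r_neq0 ab0)); rewrite mulVf ?lt0r_neq0//.
    have -> : (b - a) * (a + b) = b ^+ 2 - a ^+ 2 by ring.
    rewrite h; ring.
  have -> : a^-1 - b^-1 = (b - a) / (a * b) by field; rewrite !lt0r_neq0.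
  rewrite h1; field; rewrite !lt0r_neq0//.
have den : 0 < a * b * (a + b) by rewrite !mulr_gt0.
have aaa : 0 < a ^+ 2 * a by rewrite !mulr_gt0// exprn_gt0.
rewrite ler_pdivlMr// mulrC ler_pdivrMr//.
have a2 : 1 <= a ^+ 2 by rewrite expr_ge1// ltW.
have q : b * (a + b) <= 4 * a ^+ 2.
  by have := sqr_ge0 (a - b); lra.
have := ler_wpM2l (ltW a0) q; lra.
Qed.

Lemma sum_inv_sqrtS n : \sum_(i < n) (s i.+1)^-1 <= 2 * s n.
Proof.
elim: n => [|n IH]; first by rewrite big_ord0 mulr_ge0.
rewrite big_ord_recr /=; have := sqrtSn_ge n; rewrite invfM; lra.
Qed.

(** The term of index 0 is [0^-1 = 0], so this is the shifted sum with one term fewer. *)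
Lemma sum_inv_sqrt n : \sum_(i < n) (s i)^-1 <= 2 * s n.
Proof.
case: n => [|n]; first by rewrite big_ord0 mulr_ge0.
rewrite big_ord_recl sqrtr0 invr0 add0r; apply: le_trans (sum_inv_sqrtS n) _.
by rewrite ler_wpM2l// le_sqrtn.
Qed.

Lemma sum_inv_nsqrt n : \sum_(i < n) (i%:R * s i)^-1 <= 4.
Proof.
case: n => [|n]; first by rewrite big_ord0.
rewrite big_ord_recl mul0r invr0 add0r.
have H m : \sum_(i < m) ((i.+1)%:R * s i.+1)^-1 <= 4 * (1 - (s m.+1)^-1).
  elim: m => [|m IH]; first by rewrite big_ord0 sqrtr1 invr1 subrr mulr0.
  rewrite big_ord_recr /=; apply: le_trans (lerD IH (inv_sqrtn_tele (ltn0Sn m))) _; lra.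
have h0 : 0 <= (s n.+1)^-1 by rewrite invr_ge0.
by apply: le_trans (H n) _; lra.
Qed.

End SqrtSums.

(** * OGD-CB: trajectories *)

Section OgdState.
Context {R : realType}.
Variables (vbar rho : R) (info : bool) (T : nat).
Hypotheses (vbar_gt0 : 0 < vbar) (rho_gt0 : 0 < rho) (rho_le : rho <= vbar).
Notation path := (nat -> R).
Notation s n := (Num.sqrt (n%:R : R)).
Notation st v p t := (ogd_state info vbar rho T v p t).

Definition observed (v p : path) t : seq nat := (st v p t).1.1.1.
Definition dual (v p : path) t : R := (st v p t).1.1.2.
Definition budget (v p : path) t : R := (st v p t).1.2.
Definition active (v p : path) t : bool := ~~ (st v p t).2.
Notation x v p t := (ogd_x info vbar rho T v p t).
Notation ct v p t := (c_tilde T (observed v p t) p (v t)).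
Notation rt v p t := (r_tilde T (observed v p t) p (v t)).

Lemma ogd_inactive v p t : ~~ active v p t ->
  x v p t = false /\ st v p t.+1 = st v p t.
Proof.
rewrite /active negbK /ogd_x /=.
by case: (ogd_state _ _ _ _ _ _ _) => [[[I l] B] b] /= ->.
Qed.

Lemma ogd_xE v p t : active v p t ->
  x v p t = (t == 0%N) || (dual v p t * ct v p t <= rt v p t).
Proof.
rewrite /active /ogd_x /observed /dual.
case: (ogd_state _ _ _ _ _ _ _) => [[[I l] B] b] /= /negbTE ->.
by case: ifP.
Qed.

Definition dual_step v p t : R :=
  (vbar * s t.+1)^-1 * ((x v p t)%:R * ct v p t - rho).

Lemma ogd_step v p t : active v p t ->
  [/\ observed v p t.+1 =
        (if info || x v p t then rcons (observed v p t) t else observed v p t),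
      dual v p t.+1 = (if t == 0%N then dual v p t
                       else Num.max (dual v p t + dual_step v p t) 0),
      budget v p t.+1 = budget v p t - (x v p t)%:R * cost (v t) (p t) &
      active v p t.+1 = (vbar <= budget v p t.+1)].
Proof.
rewrite /active /ogd_x /observed /dual /budget /dual_step /ogd_x /observed /=.
case: (ogd_state _ _ _ _ _ _ _) => [[[I l] B] b] /= /negbTE -> /=.
by split=> //; rewrite -leNgt.
Qed.

Lemma ogd_inactiveE v p t : ~~ active v p t ->
  [/\ observed v p t.+1 = observed v p t, dual v p t.+1 = dual v p t,
      budget v p t.+1 = budget v p t & active v p t.+1 = active v p t].
Proof.
by move=> /ogd_inactive[_]; rewrite /observed /dual /budget /active => ->.
Qed.

Lemma ogd_init v p : [/\ observed v p 0 = [::], dual v p 0 = 0,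
  budget v p 0 = rho * T%:R & active v p 0].
Proof. by split. Qed.

Lemma activeS v p t : active v p t.+1 -> active v p t.
Proof.
by apply: contraLR => na; have [_ _ _ ->] := ogd_inactiveE na.
Qed.

Lemma observed_lt v p t i : i \in observed v p t -> (i < t)%N.
Proof.
elim: t => [//|t IH]; have [a|na] := boolP (active v p t); last first.
  by have [-> _ _ _] := ogd_inactiveE na; move=> /IH /ltnW.
have [-> _ _ _] := ogd_step a; case: ifP => _; last by move=> /IH /ltnW.
by rewrite mem_rcons inE => /predU1P[->//|/IH /ltnW].
Qed.

Lemma ogd_state_prefix v p v' p' t : (forall i, (i < t)%N -> v i = v' i) ->
  (forall i, (i < t)%N -> p i = p' i) -> st v p t = st v' p' t.
Proof.
elim: t => [//|t IH] vv pp /=.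
have E : st v p t = st v' p' t.
  by apply: IH => i it; [apply: vv|apply: pp]; exact: ltnW.
have Ip i : i \in observed v p t -> p i = p' i.
  by move=> /observed_lt it; apply: pp; exact: ltnW.
move: Ip; rewrite /observed -E vv// pp//.
case: (st v p t) => [[[I l] B] b] /= Ip.
have cE y : c_tilde T I p y = c_tilde T I p' y.
  by rewrite /c_tilde; congr (_ / _ - _); apply: eq_big_seq => i /Ip ->.
have rE y : r_tilde T I p y = r_tilde T I p' y.
  by rewrite /r_tilde; congr (_ / _ + _); apply: eq_big_seq => i /Ip ->.
by rewrite cE rE.
Qed.

Lemma ogd_decision_prefix v p p' t u : (forall i, (i < t)%N -> p i = p' i) ->
  ogd_decision T (st v p t) t p u = ogd_decision T (st v p t) t p' u.
Proof.
move=> pp.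
have Ip i : i \in observed v p t -> p i = p' i by move=> /observed_lt /pp.
move: Ip; rewrite /observed /ogd_decision.
case: (st v p t) => [[[I l] B] b] /= Ip.
rewrite /c_tilde /r_tilde.
have rE : \sum_(i <- I) rwd u (p i) = \sum_(i <- I) rwd u (p' i).
  by apply: eq_big_seq => i /Ip ->.
have cE : \sum_(i <- I) cost u (p i) = \sum_(i <- I) cost u (p' i).
  by apply: eq_big_seq => i /Ip ->.
by rewrite rE cE.
Qed.

Section BoxPath.
Variables (v p : path).
Hypotheses (bv : inboxes vbar v) (bp : inboxes vbar p).
Notation obs t := (observed v p t).
Notation n t := (size (obs t)).
Notation lam t := (dual v p t).
Notation eps t := (ogd_eps R T (n t)).

Lemma ogd_eps_ge0 m : 0 <= ogd_eps R T m.
Proof. exact: sqrtr_ge0. Qed.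

Lemma avg_box (phi : R -> R -> R) (I : seq nat) u :
  (forall w q, inbox vbar w -> inbox vbar q -> 0 <= phi w q <= w) -> inbox vbar u ->
  0 <= (\sum_(i <- I) phi u (p i)) / (size I)%:R <= u.
Proof.
move=> phib bu; have u0 : 0 <= u by have /andP[] := bu.
rewrite divr_ge0 ?sumr_ge0//=; last first.
  by move=> i _; have /andP[] := phib _ _ bu (bp i).
case: I => [|i I]; first by rewrite big_nil mul0r.
rewrite ler_pdivrMr ?ltr0n//; elim: (i :: I) => [|j J IH] /=.
  by rewrite big_nil mulr0.
rewrite big_cons -natr1 mulrDr mulr1 addrC lerD//.
by have /andP[] := phib _ _ bu (bp j).
Qed.

Lemma c_tilde_bounds t : - (2 * eps t * v t) <= ct v p t <= v t - 2 * eps t * v t.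
Proof. by have := avg_box (obs t) (@cost_box _ vbar) (bv t); rewrite /c_tilde; lra. Qed.

Lemma r_tilde_bounds t : eps t * v t <= rt v p t <= v t + eps t * v t.
Proof. by have := avg_box (obs t) (@rwd_box _ vbar) (bv t); rewrite /r_tilde; lra. Qed.

(** The multiplier rises only after an acceptance with [c_tilde > rho]. Then [2 * eps * v <= v], so
    [lam * rho <= lam * c_tilde <= r_tilde <= 3 / 2 * vbar], and the step adds at most 1. *)
Definition dual_max : R := 3 * vbar / (2 * rho) + 1.

Lemma dual_max_ge1 : 1 <= dual_max.
Proof.
by rewrite /dual_max lerDr divr_ge0 ?mulr_ge0 ?(ltW vbar_gt0) ?(ltW rho_gt0).
Qed.

Lemma dual_box t : 0 <= lam t <= dual_max.
Proof.
have L1 := dual_max_ge1.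
elim: t => [|t IH]; first by have [_ -> _ _] := ogd_init v p; lra.
have [a|na] := boolP (active v p t); last first.
  by have [_ -> _ _] := ogd_inactiveE na.
have [_ -> _ _] := ogd_step a; case: ifP => // t0.
have L0 : 0 <= dual_max by lra.
rewrite le_max lexx orbT ge_max L0 andbT /dual_step /=.
set eta := (vbar * s t.+1)^-1.
have e0 : 0 < eta by rewrite invr_gt0 mulr_gt0// sqrtn_gt0.
have ev : eta * vbar <= 1.
  rewrite /eta invfM mulrAC mulVf ?gt_eqF// mul1r invf_le1 ?sqrtn_gt0//.
  exact: sqrtn_ge1.
have /andP[c0 c1] := c_tilde_bounds t; have /andP[r0 r1] := r_tilde_bounds t.
have e_ge0 := ogd_eps_ge0 (n t).
have /andP[v0 vv] := bv t; have /andP[l0 l1] := IH.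
have [g0|g0] := leP ((x v p t)%:R * ct v p t - rho) 0.
  have := mulr_ge0_le0 (ltW e0) g0; lra.
have [xt crho] : x v p t /\ rho < ct v p t.
  move: g0; case: (x v p t); rewrite ?mul0r ?mul1r /=; first by split => //; lra.
  by move=> ?; exfalso; move: rho_gt0; lra.
have dec : lam t * ct v p t <= rt v p t by move: xt; rewrite ogd_xE// t0.
have ve : 2 * eps t * v t <= v t by move: rho_gt0; lra.
have lr : lam t * rho <= 3 / 2 * vbar.
  have : lam t * rho <= lam t * ct v p t by rewrite ler_wpM2l// ltW.
  lra.
have : lam t <= 3 * vbar / (2 * rho).
  rewrite ler_pdivlMr ?mulr_gt0//; lra.
rewrite xt mul1r /dual_max => lam_le.
have : eta * (ct v p t - rho) <= eta * vbar.
  have ev0 : 0 <= eps t * v t by rewrite mulr_ge0.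
  by rewrite ler_wpM2l ?(ltW e0)//; move: rho_gt0; lra.
lra.
Qed.

Lemma size_observed_le t : (n t <= t)%N.
Proof.
elim: t => [//|t IH]; have [a|na] := boolP (active v p t); last first.
  by have [-> _ _ _] := ogd_inactiveE na; exact: leqW.
have [-> _ _ _] := ogd_step a; case: ifP => _; last exact: leqW.
by rewrite size_rcons.
Qed.

Lemma size_observed_gt0 t : (0 < t)%N -> (0 < n t)%N.
Proof.
case: t => // t _; elim: t => [|t IH].
  have [_ _ _ a] := ogd_init v p; have [-> _ _ _] := ogd_step a.
  by rewrite ogd_xE// orbT size_rcons.
have [a|na] := boolP (active v p t.+1); last by have [-> _ _ _] := ogd_inactiveE na.
have [-> _ _ _] := ogd_step a; case: ifP => _ //.
by rewrite size_rcons.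
Qed.

(* Rejections only happen at a positive dual variable and lower it, so they
   are paid for by the acceptances that raised it; the last term covers one
   rejection at which the dual variable is clipped to [0]. *)
Lemma size_observed_potential t : (0 < t)%N -> active v p t ->
  rho * s t + vbar * lam t <=
    8 * vbar * s (n t) + (lam t == 0)%:R * (rho / s t).
Proof.
case: t => // t _; elim: t => [|t IH] a.
  have [_ l0 _ a0] := ogd_init v p; have [_ l1 _ _] := ogd_step a0.
  rewrite l1 eqxx l0 eqxx sqrtr1 divr1 mulr0 -[true%:R]/(1 : R).
  have n1 : 1 <= s (n 1) by apply: sqrtn_ge1; exact: size_observed_gt0.
  have : vbar * 1 <= vbar * s (n 1) by rewrite ler_wpM2l ?(ltW vbar_gt0).
  move: rho_gt0 rho_le vbar_gt0; lra.
have a' := activeS a; have {}IH := IH a'.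
have [oE lE _ _] := ogd_step a'.
have rt0 := sqrtn_gt0 (R := R) (ltn0Sn t.+1).
have rt1 := sqrtn_gt0 (R := R) (ltn0Sn t).
have /andP[l0 l1] := dual_box t.+1; have /andP[l0' _] := dual_box t.+2.
have up := ler_wpM2l (ltW rho_gt0) (sqrtSn_le (R := R) t.+1).
have eE : vbar * (vbar * s t.+2)^-1 = (s t.+2)^-1.
  by rewrite invfM mulrA divff ?gt_eqF// mul1r.
have ob_ge : 8 * vbar * s (n t.+1) <= 8 * vbar * s (n t.+2).
  rewrite ler_wpM2l ?mulr_ge0 ?(ltW vbar_gt0)// le_sqrtn// oE.
  by case: ifP => // _; rewrite size_rcons.
have rest0 b : 0 <= (b : bool)%:R * (rho / s t.+2).
  by rewrite mulr_ge0// divr_ge0// ltW.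
have i0 : 0 < (s t.+2)^-1 by rewrite invr_gt0.
have [xt|nxt] := boolP (x v p t.+1).
  have nE : n t.+2 = (n t.+1).+1 by rewrite oE xt orbT size_rcons.
  (* Origin of the constant 8: an acceptance raises the right side by at least [4 * vbar / s t.+2],
     since at most [t.+1] bids were observed before. This covers the growth of [rho * s], the rise
     of [vbar * lam], and the vanishing slack term, which are at most [rho], [vbar] and [2 * rho]
     over [s t.+2]. *)
  have ge1 := ler_wpM2l (mulr_ge0 (ler0n R 8) (ltW vbar_gt0)) (sqrtSn_ge (R := R) (n t.+1)).
  have le1 := le_inv_sqrtS (R := R) (size_observed_le t.+1).
  have {}le1 := ler_wpM2l (ltW vbar_gt0) le1.
  have inv2 := ler_wpM2l (ltW rho_gt0) (inv_sqrtn_le (R := R) (ltn0Sn t)).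
  have slack : (lam t.+1 == 0)%:R * (rho / s t.+1) <= rho / s t.+1.
    by case: eqP => _; rewrite ?mul1r// mul0r divr_ge0// ltW.
  have lam_le : vbar * lam t.+2 <= vbar * lam t.+1 + vbar * (s t.+2)^-1.
    have -> : vbar * (s t.+2)^-1 = vbar * ((vbar * s t.+2)^-1 * vbar).
      by rewrite mulrA eE mulrC.
    rewrite -mulrDr ler_wpM2l ?(ltW vbar_gt0)// lE /= ge_max.
    have h0 : 0 < (vbar * s t.+2)^-1 by rewrite invr_gt0 mulr_gt0.
    rewrite addr_ge0 ?mulr_ge0 ?(ltW vbar_gt0) ?(ltW h0)// andbT lerD2l.
    rewrite /dual_step ler_wpM2l ?(ltW h0)// xt mul1r.
    have /andP[_ c1] := c_tilde_bounds t.+1; have /andP[v0 vv] := bv t.+1.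
    have : 0 <= ogd_eps R T (n t.+1) * v t.+1 by rewrite mulr_ge0 ?ogd_eps_ge0.
    move: rho_gt0; lra.
  have rv : rho * (s t.+2)^-1 <= vbar * (s t.+2)^-1 by rewrite ler_wpM2r// ltW.
  have := rest0 (lam t.+2 == 0).
  rewrite nE in ob_ge *; rewrite invfM in ge1; lra.
have lam_gt0 : lam t.+1 != 0.
  apply: contraNneq nxt => l00; rewrite ogd_xE// l00 mul0r /=.
  have /andP[r0 _] := r_tilde_bounds t.+1; apply: le_trans r0.
  by rewrite mulr_ge0 ?ogd_eps_ge0//; have /andP[] := bv t.+1.
rewrite (negbTE lam_gt0) mul0r addr0 in IH.
have stepE : vbar * dual_step v p t.+1 = - (rho * (s t.+2)^-1).
  by rewrite /dual_step (negbTE nxt) mul0r sub0r mulrA eE mulrN mulrC.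
(* Unclipped, [vbar * lam] falls by exactly [rho / s t.+2], which covers the growth of [rho * s];
   clipped, the slack term covers it. *)
have [pos|neg] := leP 0 (lam t.+1 + dual_step v p t.+1).
  have -> : lam t.+2 = lam t.+1 + dual_step v p t.+1 by rewrite lE /= max_l.
  rewrite mulrDr stepE; have := rest0 (lam t.+1 + dual_step v p t.+1 == 0); lra.
have -> : lam t.+2 = 0 by rewrite lE /= max_r// ltW.
have := mulr_ge0 (ltW vbar_gt0) l0.
rewrite eqxx mul1r mulr0; lra.
Qed.

(** The 9 is the 8 of the potential plus 1 for its slack term, which is at most [vbar * s (n t)]. *)
Definition obs_rate : R := (rho / (9 * vbar)) ^+ 2.

Lemma size_observed_ge t : (0 < t)%N -> active v p t ->
  obs_rate * t%:R <= (n t)%:R.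
Proof.
move=> t0 a; have H := size_observed_potential t0 a.
have n0 := sqrtn_ge1 (R := R) (size_observed_gt0 t0).
have s1 := sqrtn_ge1 (R := R) t0; have sp := sqrtn_gt0 (R := R) t0.
have slack : (lam t == 0)%:R * (rho / s t) <= vbar * s (n t).
  apply: (@le_trans _ _ (rho / s t)).
    by case: eqP => _; rewrite ?mul1r// mul0r divr_ge0// ltW.
  apply: (@le_trans _ _ rho); first by rewrite ler_pdivrMr// ler_peMr// ltW.
  by apply: (le_trans rho_le); rewrite ler_peMr// ltW.
have /andP[l0 _] := dual_box t; have vl := mulr_ge0 (ltW vbar_gt0) l0.
have : rho / (9 * vbar) * s t <= s (n t).
  rewrite mulrAC ler_pdivrMr ?mulr_gt0//; lra.
rewrite -(ler_pXn2r (ltn0Sn 1)) ?nnegrE ?mulr_ge0 ?invr_ge0 ?mulr_ge0 ?(ltW vbar_gt0) ?(ltW rho_gt0)//.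
by rewrite exprMn !sqr_sqrtn.
Qed.

End BoxPath.
End OgdState.

(** * OGD-CB: estimation errors *)

Section OgdMartingales.
Context {R : realType}.
Variables (vbar rho : R) (F G : probability R R) (info : bool) (T : nat).
Hypotheses (vbar_gt0 : 0 < vbar) (rho_gt0 : 0 < rho) (rho_le : rho <= vbar).
Notation path := (nat -> R).
Notation s n := (Num.sqrt (n%:R : R)).
Notation st v p t := (ogd_state info vbar rho T v p t).
Notation x v p t := (ogd_x info vbar rho T v p t).
Notation obs v p t := (observed vbar rho info T v p t).
Notation act v p t := (active vbar rho info T v p t).
Notation lam v p t := (dual vbar rho info T v p t).
Let rbar := mean vbar F G (@rwd R).
Let cbar := mean vbar F G (@cost R).
Let k := obs_rate vbar rho.

Definition rowmean (phi : R -> R -> R) (u : R) : R := boxint vbar G (phi u).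

Definition dev (phi : R -> R -> R) (I : seq nat) (p : path) (u : R) : R :=
  \sum_(i <- I) (phi u (p i) - rowmean phi u).

(** For past observations [I] this is the conditional mean of the squared deviation at the fresh
    value [v_t]. *)
Definition dvar phi I p : R := boxint vbar F (fun u => dev phi I p u ^+ 2).

(** Coefficient of [d ^+ 2 / (t * s t)] when Young's inequality with weight [vbar * s t] is applied
    to [|d| / (k * t)]. *)
Definition dev_coef : R := (2 * k * vbar)^-1.

Definition observes v p t : R :=
  (act v p t)%:R * (if info then 1 else (x v p t)%:R).

(** Absolute error of the empirical mean of [phi] at the current value, counted only before
    stopping. *)
Definition dev_jump phi v p t : R :=
  (act v p t)%:R * (`|dev phi (obs v p t) p (v t)| / (size (obs v p t))%:R).

(** The first term replaces the squared deviation at [v_t] by its conditional mean [dvar]; the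
    second is the cross term by which [dvar] changes when a new bid is observed. *)
Definition dev_mart phi t v p : R :=
  (act v p t)%:R * (dev_coef / (t%:R * s t)) *
    (dev phi (obs v p t) p (v t) ^+ 2 - dvar phi (obs v p t) p) +
  2 * (4 * dev_coef / s t.+1) * (observes v p t *
    boxint vbar F (fun u => dev phi (obs v p t) p u * (phi u (p t) - rowmean phi u))).

(** The decision depends on [v_t], so it may multiply only the bid noise; the value noise is that of
    the Lagrangian, whose multiplier belongs to the past. *)
Definition regret_mart t v p : R :=
  (x v p t)%:R * (rwd (v t) (p t) - rowmean (@rwd R) (v t)) +
  (act v p t)%:R * ((rowmean (@rwd R) (v t) - rbar) -
     lam v p t * (rowmean (@cost R) (v t) - cbar)).

(** Costs are centered given the value, not by [cbar], because acceptance is correlated with the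
    value. *)
Definition overspend v p t : R :=
  \sum_(i < t) (x v p i)%:R * (cost (v i) (p i) - rowmean (@cost R) (v i)).

Definition spend_mart t v p : R :=
  overspend v p t * ((x v p t)%:R * (cost (v t) (p t) - rowmean (@cost R) (v t))).

Section Prefix.
Variables (v p v' p' : path).

Lemma ogd_x_prefix t : (forall i, (i <= t)%N -> v i = v' i) ->
  (forall i, (i <= t)%N -> p i = p' i) -> x v p t = x v' p' t.
Proof.
move=> vv pp; rewrite /ogd_x vv//.
rewrite (@ogd_state_prefix _ _ _ _ _ v p v' p'); last 2 first.
- by move=> i it; apply: vv; exact: ltnW.
- by move=> i it; apply: pp; exact: ltnW.
by apply/esym; apply: ogd_decision_prefix => i it; rewrite pp// ltnW.
Qed.

Lemma dev_prefix phi I u : (forall i, i \in I -> p i = p' i) ->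
  dev phi I p u = dev phi I p' u.
Proof. by move=> pp; apply: eq_big_seq => i iI; rewrite pp. Qed.

End Prefix.

Lemma ogd_state_adapt v p v' p' t : (forall i, (i <= t)%N -> v i = v' i) ->
  (forall i, (i <= t)%N -> p i = p' i) ->
  [/\ obs v p t = obs v' p' t, act v p t = act v' p' t, lam v p t = lam v' p' t &
      x v p t = x v' p' t].
Proof.
move=> vv pp; have stE : st v p t = st v' p' t.
  by apply: ogd_state_prefix => i /ltnW it; [exact: vv|exact: pp].
by rewrite /observed /active /dual stE (ogd_x_prefix vv pp).
Qed.

Lemma observed_prefix v p p' t i : (forall i, (i <= t)%N -> p i = p' i) ->
  i \in obs v p t -> p i = p' i.
Proof. by move=> pp /observed_lt /ltnW; exact: pp. Qed.

Lemma dev_mart_adapted phi : adapted (dev_mart phi).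
Proof.
move=> t v p v' p' vv pp.
have pI i (iI : i \in obs v p t) := observed_prefix pp iI.
have [oE aE _ xE] := ogd_state_adapt vv pp.
have dE : dev phi (obs v p t) p = dev phi (obs v' p' t) p'.
  by apply/funext => u; rewrite -oE; exact: dev_prefix.
by rewrite /dev_mart /observes /dvar dE aE xE vv// pp.
Qed.

Lemma regret_mart_adapted : adapted regret_mart.
Proof.
move=> t v p v' p' vv pp; have [_ aE lE xE] := ogd_state_adapt vv pp.
by rewrite /regret_mart aE lE xE vv// pp.
Qed.

Lemma spend_mart_adapted : adapted spend_mart.
Proof.
move=> t v p v' p' vv pp; have [_ _ _ xE] := ogd_state_adapt vv pp.
rewrite /spend_mart xE vv// pp//; congr (_ * _).
apply: eq_bigr => i _; have it := ltnW (ltn_ord i).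
have [_ _ _ ->] : [/\ obs v p i = obs v' p' i, act v p i = act v' p' i,
    lam v p i = lam v' p' i & x v p i = x v' p' i].
  by apply: ogd_state_adapt => j ji; [apply: vv|apply: pp]; exact: leq_trans ji it.
by rewrite vv// pp.
Qed.

Lemma bmeas1_ler (f g : R -> R) : bmeas1 vbar f -> bmeas1 vbar g ->
  bmeas1 vbar (fun u => ((f u <= g u)%R)%:R).
Proof.
move=> [mf _] [mg _]; split; last by exists 1 => u _; rewrite normr_nat lern1 leq_b1.
have mb : measurable_fun setT (fun b : bool => b%:R : R) by [].
by apply: (measurableT_comp mb); exact: measurable_fun_ler.
Qed.

Section Step.
Variables (a b : path) (t : nat).
Hypotheses (ba : inboxes vbar a) (bb : inboxes vbar b).

Lemma bmeas1_avg phi I : bmeas2 vbar phi ->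
  bmeas1 vbar (fun u => (\sum_(i <- I) phi u (b i)) / (size I)%:R).
Proof.
move=> bphi; apply: bmeas1M (bmeas1_cst _ _).
by apply: bmeas1_sum => i _; apply: bmeas2_col bphi _.
Qed.

Lemma bmeas1_decision :
  bmeas1 vbar (fun u => (ogd_decision T (st a b t) t b u)%:R).
Proof.
rewrite /ogd_decision; case: (st a b t) => [[[I l] B] []]; first exact: bmeas1_cst.
case: (t == 0%N); first exact: bmeas1_cst.
apply: (@bmeas1_ler (fun u => l * c_tilde T I b u) (r_tilde T I b)).
  apply: bmeas1M; first exact: bmeas1_cst.
  apply: bmeas1B; first by apply: bmeas1_avg; exact: bmeas2_cost.
  by apply: bmeas1M; [exact: bmeas1_cst|exact: bmeas1_id].
apply: bmeas1D; first by apply: bmeas1_avg; exact: bmeas2_rwd.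
by apply: bmeas1M; [exact: bmeas1_cst|exact: bmeas1_id].
Qed.

Lemma bmeas1_dev phi I : bmeas2 vbar phi -> bmeas1 vbar (dev phi I b).
Proof.
move=> bphi; apply: bmeas1_sum => i _; apply: bmeas1B.
  by apply: bmeas2_col bphi _.
exact: bmeas1_boxint.
Qed.

Let dec u := ogd_decision T (st a b t) t b u.

Lemma upd_state y q : [/\ obs (upd a t y) (upd b t q) t = obs a b t,
  act (upd a t y) (upd b t q) t = act a b t,
  lam (upd a t y) (upd b t q) t = lam a b t &
  x (upd a t y) (upd b t q) t = dec y].
Proof.
have stE : st (upd a t y) (upd b t q) t = st a b t.
  by apply: ogd_state_prefix => i it; rewrite upd_lt.
rewrite /observed /active /dual /ogd_x stE upd_eq; split=> //.
by apply/esym; apply: ogd_decision_prefix => i it; rewrite upd_lt.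
Qed.

Lemma dev_mart_centered phi : bmeas2 vbar phi ->
  centered vbar F G (fun y q => dev_mart phi t (upd a t y) (upd b t q)).
Proof.
move=> bphi; pose I := obs a b t.
have bd := bmeas1_dev I bphi.
have bd2 : bmeas1 vbar (fun u => dev phi I b u ^+ 2) by exact: bmeas1M.
have by' : bmeas1 vbar (fun y => (act a b t)%:R * (if info then 1 else (dec y)%:R)).
  apply: bmeas1M; first exact: bmeas1_cst.
  by case: info; [exact: bmeas1_cst|exact: bmeas1_decision].
have c1 := centeredZ vbar_gt0 ((act a b t)%:R * (dev_coef / (t%:R * s t)))
  (centered_fst vbar_gt0 F G bd2).
have c2 := centeredZ vbar_gt0 (2 * (4 * dev_coef / s t.+1))
  (centered_cross vbar_gt0 F G by' bd bphi).
apply: eq_centered (centeredD vbar_gt0 c1 c2) => y q.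
have [oE aE _ xE] := upd_state y q.
have dE : dev phi I (upd b t q) = dev phi I b.
  apply/funext => u; apply: dev_prefix => i /observed_lt it; exact: upd_lt.
by rewrite /dev_mart /observes /dvar oE aE xE !upd_eq -/I dE.
Qed.

Lemma regret_mart_centered :
  centered vbar F G (fun y q => regret_mart t (upd a t y) (upd b t q)).
Proof.
have bdec := bmeas1_decision.
have br := bmeas1_boxint vbar_gt0 G (bmeas2_rwd vbar).
have bc := bmeas1_boxint vbar_gt0 G (bmeas2_cost vbar).
have c1 := centered_snd vbar_gt0 F G bdec (bmeas2_rwd vbar).
have c2 := centeredB vbar_gt0 (centered_fst vbar_gt0 F G br)
  (centeredZ vbar_gt0 (lam a b t) (centered_fst vbar_gt0 F G bc)).
have c3 := centeredZ vbar_gt0 (act a b t)%:R c2.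
apply: eq_centered (centeredD vbar_gt0 c1 c3) => y q.
have [oE aE lE xE] := upd_state y q.
by rewrite /regret_mart aE lE xE !upd_eq.
Qed.

Lemma spend_mart_centered :
  centered vbar F G (fun y q => spend_mart t (upd a t y) (upd b t q)).
Proof.
have bdec := bmeas1_decision.
have c1 := centered_snd vbar_gt0 F G bdec (bmeas2_cost vbar).
apply: eq_centered (centeredZ vbar_gt0 (overspend a b t) c1) => y q.
have [_ _ _ xE] := upd_state y q.
rewrite /spend_mart xE !upd_eq; congr (_ * _).
apply: eq_bigr => i _; rewrite !upd_lt//.
by rewrite (@ogd_x_prefix _ _ a b)// => j ji; rewrite upd_lt//;
  exact: leq_ltn_trans ji _.
Qed.

End Step.

Section DevPath.
Variables (phi : R -> R -> R) (v p : path).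
Hypotheses (bphi : bmeas2 vbar phi)
  (phi_box : forall u q, inbox vbar u -> inbox vbar q -> 0 <= phi u q <= u).
Hypotheses (bv : inboxes vbar v) (bp : inboxes vbar p).

Lemma rowmean_box u : inbox vbar u -> 0 <= rowmean phi u <= u.
Proof.
move=> bu; have bpu := bmeas2_row bphi bu.
rewrite /rowmean boxint_ge0//=; last by move=> q bq; have /andP[] := phi_box bu bq.
rewrite -[leRHS](boxint_cst vbar G); apply: le_boxint => //; first exact: bmeas1_cst.
by move=> q bq; have /andP[] := phi_box bu bq.
Qed.

Lemma sqr_centered_le u q : inbox vbar u -> inbox vbar q ->
  (phi u q - rowmean phi u) ^+ 2 <= vbar ^+ 2.
Proof.
move=> bu bq; have /andP[r0 r1] := rowmean_box bu.
have /andP[f0 f1] := phi_box bu bq; have /andP[u0 u1] := bu.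
set d := phi u q - _.
have : 0 <= (vbar - d) * (vbar + d) by rewrite mulr_ge0// /d; lra.
lra.
Qed.

Lemma dvar_ge0 I : 0 <= dvar phi I p.
Proof. by apply: boxint_ge0 => // u _; exact: sqr_ge0. Qed.

Lemma dvar_rcons I i : dvar phi (rcons I i) p <= dvar phi I p +
  2 * boxint vbar F (fun u => dev phi I p u * (phi u (p i) - rowmean phi u)) + vbar ^+ 2.
Proof.
have bd := bmeas1_dev bp I bphi.
have be : bmeas1 vbar (fun u => phi u (p i) - rowmean phi u).
  by apply: bmeas1B; [exact: bmeas2_col bphi _|exact: bmeas1_boxint].
have bd2 : bmeas1 vbar (fun u => dev phi I p u ^+ 2) by exact: bmeas1M.
have bde := bmeas1M bd be.
rewrite /dvar -boxintZ// -boxintD//; last by apply: bmeas1M => //; exact: bmeas1_cst.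
rewrite -[X in _ + X](boxint_cst vbar F) -boxintD//; last 2 first.
- by apply: bmeas1D => //; apply: bmeas1M => //; exact: bmeas1_cst.
- exact: bmeas1_cst.
apply: le_boxint => //.
- by rewrite /=; apply: bmeas1M; apply: bmeas1_dev.
- by apply: bmeas1D (bmeas1_cst _ _); apply: bmeas1D => //; apply: bmeas1M => //; exact: bmeas1_cst.
move=> u bu; rewrite {1}/dev -cats1 big_cat big_seq1 /= -/(dev phi I p u).
have := sqr_centered_le bu (bp i); lra.
Qed.

Lemma obs_rate_gt0 : 0 < k.
Proof. by rewrite exprn_gt0// divr_gt0// mulr_gt0. Qed.

Lemma dev_coef_gt0 : 0 < dev_coef.
Proof.
have k0 := obs_rate_gt0.
by rewrite invr_gt0; apply: mulr_gt0 => //; exact: mulr_gt0.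
Qed.

(** Young's inequality after bounding the number of observations below by [k * t]; at [t = 0] there
    is no observation and the left side is 0. *)
Lemma dev_jump_le t : dev_jump phi v p t <= vbar / (2 * k) / s t +
  (act v p t)%:R * (dev_coef / (t%:R * s t)) * dev phi (obs v p t) p (v t) ^+ 2.
Proof.
have k0 := obs_rate_gt0; have c0 := dev_coef_gt0.
have h0 : 0 <= vbar / (2 * k) / s t.
  apply: divr_ge0 (sqrtr_ge0 _); apply: divr_ge0; first exact: ltW.
  by apply: mulr_ge0 => //; exact: ltW.
rewrite /dev_jump; have [a|_] := boolP (act v p t); last by rewrite !mul0r addr0.
rewrite !mul1r; case: t a h0 => [|t] a h0.
  by rewrite /dev /= big_nil normr0 mul0r expr0n mulr0 addr0.
set d := dev _ _ _ _; have st0 := sqrtn_gt0 (R := R) (ltn0Sn t).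
have n0 := size_observed_ge vbar_gt0 rho_gt0 rho_le bv bp (ltn0Sn t) a.
have kt0 : 0 < k * t.+1%:R by rewrite mulr_gt0.
apply: (@le_trans _ _ (`|d| / (k * t.+1%:R))).
  by rewrite ler_wpM2l// lef_pV2 ?posrE// (lt_le_trans kt0).
have -> : vbar / (2 * k) / s t.+1 + dev_coef / (t.+1%:R * s t.+1) * d ^+ 2 =
    (`|d| + (vbar * s t.+1 - `|d|) ^+ 2 / (2 * vbar * s t.+1)) / (k * t.+1%:R).
  rewrite /dev_coef; set r := s t.+1 in st0 *.
  have -> : t.+1%:R = r ^+ 2 by rewrite /r sqr_sqrtn.
  rewrite -[d ^+ 2](real_normK (num_real _)).
  by field; rewrite !gt_eqF.
rewrite ler_wpM2r ?invr_ge0 ?(ltW kt0)// lerDl divr_ge0 ?sqr_ge0//.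
by rewrite !mulr_ge0 ?(ltW vbar_gt0).
Qed.

(* The [dvar] term is a potential that pays for the future errors made with the
   current observations.  Terms of index [0] vanish, as [0^-1 = 0]. *)
Lemma dev_path t :
  \sum_(i < t) dev_jump phi v p i + 4 * dev_coef / s t * dvar phi (obs v p t) p <=
  \sum_(i < t) (vbar / (2 * k) / s i + 4 * dev_coef * vbar ^+ 2 / s i.+1) +
  \sum_(i < t) dev_mart phi i v p.
Proof.
have c0 := dev_coef_gt0.
elim: t => [|t IH]; first by rewrite !big_ord0 sqrtr0 invr0 mulr0 mul0r !add0r.
rewrite !big_ord_recr /=.
have jl := dev_jump_le t.
set A := 4 * dev_coef / s t in IH *; set A' := 4 * dev_coef / s t.+1.
have A'0 : 0 <= A' by rewrite divr_ge0// mulr_ge0// ltW.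
have D0 := dvar_ge0 (obs v p t).
set c := dev_coef / (t%:R * s t) in jl *.
(* The decrease of the potential's weight pays for the current error. This is where its factor 4
   comes from; at [t = 0], [dvar] is 0. *)
have AA : (c + A') * dvar phi (obs v p t) p <= A * dvar phi (obs v p t) p.
  have [->|t0] := posnP t.
    by rewrite /dvar (@eq_boxint _ _ _ _ _ (fun=> 0)) ?boxint_cst ?mulr0// => u _;
      rewrite /dev big_nil expr0n.
  rewrite ler_wpM2r//; have := ler_wpM2l (ltW c0) (inv_sqrtn_tele (R := R) t0).
  by rewrite /c /A /A'; lra.
have aE : 4 * dev_coef * vbar ^+ 2 / s t.+1 = A' * vbar ^+ 2 by rewrite /A'; ring.
rewrite aE.
have [a|na] := boolP (act v p t); last first.
  have [-> _ _ _] := ogd_inactiveE na.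
  have : c * dvar phi (obs v p t) p >= 0.
    by rewrite mulr_ge0 ?divr_ge0 ?mulr_ge0 ?(ltW c0).
  have : 0 <= A' * vbar ^+ 2 by rewrite mulr_ge0 ?sqr_ge0.
  move: jl; rewrite /dev_mart /observes (negbTE na) !mul0r mulr0 !add0r addr0; lra.
have [oE _ _ _] := ogd_step a.
have obs_le : dvar phi (obs v p t.+1) p <= dvar phi (obs v p t) p +
    2 * (observes v p t * boxint vbar F
      (fun u => dev phi (obs v p t) p u * (phi u (p t) - rowmean phi u))) + vbar ^+ 2.
  have rl := dvar_rcons (obs v p t) t; have v2 := sqr_ge0 vbar.
  have yE : observes v p t = (info || x v p t)%:R.
    by rewrite /observes a mul1r; case: (info) (x v p t) => [] [].
  rewrite oE yE; case: (info || x v p t); rewrite ?mul1r//.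
  by rewrite mul0r mulr0; lra.
have := ler_wpM2l A'0 obs_le.
move: jl; rewrite /dev_mart a !mul1r -/c -/A'.
lra.
Qed.

End DevPath.
End OgdMartingales.

(** * OGD-CB: regret and spending *)

Section OgdRegret.
Context {R : realType}.
Variables (vbar rho : R) (F G : probability R R) (info : bool) (T : nat).
Hypotheses (vbar_gt0 : 0 < vbar) (rho_gt0 : 0 < rho) (rho_le : rho <= vbar).
Hypothesis T_large : vbar <= rho * T%:R.
Notation path := (nat -> R).
Notation s n := (Num.sqrt (n%:R : R)).
Notation x v p t := (ogd_x info vbar rho T v p t).
Notation obs v p t := (observed vbar rho info T v p t).
Notation act v p t := (active vbar rho info T v p t).
Notation lam v p t := (dual vbar rho info T v p t).
Notation bud v p t := (budget vbar rho info T v p t).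
Notation jump phi v p t := (dev_jump vbar rho G info T phi v p t).
Notation cmean := (rowmean vbar G (@cost R)).
Let rbar := mean vbar F G (@rwd R).
Let cbar := mean vbar F G (@cost R).
Let k := obs_rate vbar rho.
Let Lam := dual_max vbar rho.
Hypothesis cbar_le : cbar <= rho.

Definition eps_rate : R := Num.sqrt ((ln 2 + 2 * ln T%:R) / (2 * k)).

Lemma T_gt0 : (0 < T)%N.
Proof.
case: T T_large => // /(lt_le_trans vbar_gt0); by rewrite mulr0 ltxx.
Qed.

Section Path.
Variables (v p : path).
Hypotheses (bv : inboxes vbar v) (bp : inboxes vbar p).

Lemma ogd_eps_le t : (0 < t)%N -> act v p t ->
  ogd_eps R T (size (obs v p t)) <= eps_rate / s t.
Proof.
move=> t0 a; have st0 := sqrtn_gt0 (R := R) t0.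
have k0 := obs_rate_gt0 vbar_gt0 rho_gt0.
have n0 := size_observed_ge vbar_gt0 rho_gt0 rho_le bv bp t0 a.
have T1 : 1 <= T%:R :> R by rewrite ler1n T_gt0.
have L0 : 0 <= ln 2 + 2 * ln (T%:R : R).
  by rewrite addr_ge0 ?mulr_ge0 ?ln_ge0// ler1n.
have kt0 : 0 < k * t%:R by rewrite mulr_gt0// ltr0n.
have nn0 : 0 < (size (obs v p t))%:R :> R by apply: lt_le_trans n0.
rewrite ler_pdivlMr// /ogd_eps /eps_rate -sqrtrM ?divr_ge0 ?mulr_ge0//.
rewrite ler_wsqrtr//; set L := _ + _ in L0 *; set m := size _ in n0 nn0 *.
have -> : L / (2 * m%:R) * t%:R = L * (t%:R / (2 * m%:R)) by ring.
rewrite ler_wpM2l// ler_pdivrMr ?mulr_gt0//.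
have -> : (2 * k)^-1 * (2 * m%:R) = m%:R / k by field; rewrite gt_eqF.
by rewrite ler_pdivlMr// mulrC.
Qed.

Lemma avg_dev phi I u : (0 < size I)%N ->
  (\sum_(i <- I) phi u (p i)) / (size I)%:R =
  rowmean vbar G phi u + dev vbar G phi I p u / (size I)%:R.
Proof.
move=> I0; have n0 : (size I)%:R != 0 :> R by rewrite pnatr_eq0 -lt0n.
rewrite /dev sumrB big_const_seq count_predT iter_addr_0 -mulr_natr.
by field.
Qed.

Lemma jump_ge phi t : act v p t ->
  `|dev vbar G phi (obs v p t) p (v t) / (size (obs v p t))%:R| <= jump phi v p t.
Proof.
by move=> a; rewrite /dev_jump a mul1r normrM normfV [X in _ / X]ger0_norm.
Qed.

Lemma jump_ge0 phi t : 0 <= jump phi v p t.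
Proof. by rewrite /dev_jump !mulr_ge0 ?invr_ge0. Qed.

(* Accepting maximizes [r_tilde - lam * c_tilde], up to the estimation errors. *)
Lemma accept_value t : (0 < t)%N -> act v p t ->
  rowmean vbar G (@rwd R) (v t) - lam v p t * cmean (v t)
    + lam v p t * ((x v p t)%:R * c_tilde T (obs v p t) p (v t))
    - jump (@rwd R) v p t - Lam * jump (@cost R) v p t
  <= (x v p t)%:R * rowmean vbar G (@rwd R) (v t).
Proof.
move=> t0 a; have n0 := size_observed_gt0 vbar rho info T v p t0.
have /andP[l0 l1] := dual_box info T vbar_gt0 rho_gt0 bv bp t.
have e0 := ogd_eps_ge0 (R := R) T (size (obs v p t)).
have ev : 0 <= ogd_eps R T (size (obs v p t)) * v t.
  by rewrite mulr_ge0//; have /andP[] := bv t.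
have := jump_ge (@rwd R) a; have := jump_ge (@cost R) a.
have jr0 := jump_ge0 (@rwd R) t; have jc0 := jump_ge0 (@cost R) t.
have dec := ogd_xE a.
move: dec; rewrite (gtn_eqF t0) /= /c_tilde /r_tilde !avg_dev//.
set dr := dev _ _ (@rwd R) _ _ _ / _; set dc := dev _ _ (@cost R) _ _ _ / _.
set jr := jump (@rwd R) _ _ _ in jr0 *; set jc := jump (@cost R) _ _ _ in jc0 *.
set rm := rowmean _ _ (@rwd R) _; set cm := rowmean _ _ (@cost R) _.
set l := lam v p t in l0 l1 *; set e := ogd_eps _ _ _ * v t in ev *.
rewrite !ler_norml => dec /andP[c1 c2] /andP[r1 r2].
have lj : l * jc <= Lam * jc by rewrite ler_wpM2r.
have lc : l * (cm + dc - 2 * ogd_eps R T (size (obs v p t)) * v t) <= l * (cm + jc).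
  by rewrite ler_wpM2l// -mulrA -/e; lra.
move: dec lc; set ct := cm + dc - _ => dec lc.
(* If accepted, only [lam * (c_tilde - cmean)] is to be bounded, and subtracting the confidence
   width helps. If rejected, [r_tilde < lam * c_tilde] bounds the value forgone by the two
   errors. *)
case: (x v p t) dec => dec; rewrite ?mul1r ?mul0r ?mulr0; first lra.
have {}dec : rm + dr + e < l * ct by rewrite ltNge -dec.
lra.
Qed.

(** One gradient step against the comparator [0], scaled by half the inverse step size. The gradient
    is at most [2 * vbar * (1 + eps)], so its square is at most [8 * vbar ^+ 2 * (1 + eps ^+ 2)],
    whence the two error terms. *)
Lemma dual_regret t : (0 < t)%N -> act v p t ->
  (vbar * s t.+1 / 2) * (lam v p t.+1 ^+ 2 - lam v p t ^+ 2)
    - 4 * vbar * ((s t.+1)^-1 + eps_rate ^+ 2 / (t%:R * s t))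
  <= lam v p t * ((x v p t)%:R * c_tilde T (obs v p t) p (v t) - rho).
Proof.
move=> t0 a; have st0 := sqrtn_gt0 (R := R) t0.
have st1 := sqrtn_gt0 (R := R) (ltn0Sn t).
have [_ -> _ _] := ogd_step a; rewrite (gtn_eqF t0) /dual_step.
have /andP[c0 c1] := c_tilde_bounds rho info T bv bp t.
have e0 := ogd_eps_ge0 (R := R) T (size (obs v p t)).
have eE := ogd_eps_le t0 a.
set g := (x v p t)%:R * _ - rho; set l := lam v p t.
set e := ogd_eps _ _ _ in c0 c1 e0 eE.
have /andP[v0 vv] := bv t.
have ev : e * v t <= e * vbar by rewrite ler_wpM2l.
have ev0 : 0 <= e * v t by rewrite mulr_ge0.
have evb : 0 <= e * vbar by rewrite mulr_ge0// ltW.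
have g_le : `|g| <= 2 * vbar * (1 + e).
  rewrite ler_norml /g; move: rho_gt0 rho_le vbar_gt0 => r0 r1 v1.
  by case: (x v p t); rewrite ?mul1r ?mul0r; apply/andP; split; lra.
have g2 : g ^+ 2 <= 8 * vbar ^+ 2 * (1 + e ^+ 2).
  rewrite -(real_normK (num_real g)).
  apply: (@le_trans _ _ ((2 * vbar * (1 + e)) ^+ 2)).
    by rewrite ler_pXn2r// nnegrE ?normr_ge0// (le_trans _ g_le).
  have := mulr_ge0 (sqr_ge0 vbar) (sqr_ge0 (1 - e)); lra.
have e2 : e ^+ 2 <= eps_rate ^+ 2 / t%:R.
  have -> : eps_rate ^+ 2 / t%:R = (eps_rate / s t) ^+ 2.
    by rewrite exprMn exprVn sqr_sqrtn.
  by rewrite ler_pXn2r// nnegrE// (le_trans _ eE).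
set w := vbar * s t.+1.
have w0 : 0 < w by rewrite mulr_gt0.
have sq : Num.max (l + w^-1 * g) 0 ^+ 2 <= l ^+ 2 + 2 * w^-1 * (l * g) + w^-1 ^+ 2 * g ^+ 2.
  have -> : l ^+ 2 + 2 * w^-1 * (l * g) + w^-1 ^+ 2 * g ^+ 2 = (l + w^-1 * g) ^+ 2 by ring.
  have [h|h] := leP 0 (l + w^-1 * g); first by rewrite lexx.
  by rewrite expr0n sqr_ge0.
have w2 : 0 <= w / 2 by rewrite divr_ge0// ltW.
have := ler_wpM2l w2 sq.
have -> : w / 2 * (l ^+ 2 + 2 * w^-1 * (l * g) + w^-1 ^+ 2 * g ^+ 2) =
   w / 2 * l ^+ 2 + l * g + g ^+ 2 / (2 * w) by field; rewrite gt_eqF.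
have gw : g ^+ 2 / (2 * w) <= 4 * vbar * ((s t.+1)^-1 + eps_rate ^+ 2 / (t%:R * s t)).
  apply: (@le_trans _ _ (8 * vbar ^+ 2 * (1 + e ^+ 2) / (2 * w))).
    by rewrite ler_wpM2r// invr_ge0 mulr_ge0// ltW.
  have -> : 8 * vbar ^+ 2 * (1 + e ^+ 2) / (2 * w) =
      4 * vbar * ((s t.+1)^-1 + e ^+ 2 / s t.+1).
    by rewrite /w; field; rewrite !gt_eqF.
  rewrite ler_wpM2l ?mulr_ge0 ?(ltW vbar_gt0)// lerD2l invfM mulrA.
  apply: ler_pM => //; rewrite ?invr_ge0 ?sqr_ge0 ?sqrtr_ge0//.
  by rewrite lef_pV2 ?posrE// le_sqrtn.
lra.
Qed.

Definition reg_rate (i : nat) : R :=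
  4 * vbar * ((s i.+1)^-1 + eps_rate ^+ 2 / (i%:R * s i)).

Lemma reg_rate_ge0 i : 0 <= reg_rate i.
Proof.
rewrite /reg_rate; apply: mulr_ge0; first by rewrite mulr_ge0// ltW.
apply: addr_ge0; first by rewrite invr_ge0.
by apply: divr_ge0; [exact: sqr_ge0|rewrite mulr_ge0].
Qed.

(** Subtracting [Lam ^+ 2] makes the telescoping bracket nonpositive, so its weight may grow with
    [s t]; this absorbs the decreasing step size. In round 0 the multiplier is 0 and acceptance is
    forced; after stopping, only losses are added. *)
Lemma regret_path t :
  (\sum_(i < t) (act v p i)%:R) * rbar + \sum_(i < t) regret_mart vbar rho F G info T i v p
   + vbar * s t / 2 * (lam v p t ^+ 2 - Lam ^+ 2)
   - \sum_(i < t) jump (@rwd R) v p i - Lam * \sum_(i < t) jump (@cost R) v p i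
   - \sum_(i < t) reg_rate i
  <= \sum_(i < t) (x v p i)%:R * rwd (v i) (p i).
Proof.
have LL i : lam v p i ^+ 2 <= Lam ^+ 2.
  have /andP[l0 l1] := dual_box info T vbar_gt0 rho_gt0 bv bp i.
  by rewrite ler_pXn2r// nnegrE// (le_trans l0).
have L1 : 1 <= Lam by exact: dual_max_ge1.
elim: t => [|t IH]; first by rewrite !big_ord0 sqrtr0; lra.
rewrite !big_ord_recr /=.
have jr0 := jump_ge0 (@rwd R) t; have jc0 := jump_ge0 (@cost R) t.
have d0 := reg_rate_ge0 t.
have ljc : 0 <= Lam * jump (@cost R) v p t by rewrite mulr_ge0//; lra.
have ss : vbar * s t.+1 / 2 * (lam v p t ^+ 2 - Lam ^+ 2) <=
    vbar * s t / 2 * (lam v p t ^+ 2 - Lam ^+ 2).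
  rewrite ler_wnM2r ?subr_le0// ler_wpM2r// ler_wpM2l ?(ltW vbar_gt0)//.
  by rewrite le_sqrtn.
rewrite [regret_mart vbar rho F G info T t v p]/regret_mart -/rbar -/cbar.
have [a|na] := boolP (act v p t); last first.
  have [_ -> _ _] := ogd_inactiveE na; have [-> _] := ogd_inactive na.
  rewrite -[false%:R]/(0 : R) !mul0r !addr0; lra.
have [t0|t0] := posnP t.
  subst t; have [_ -> _ _] := ogd_step a; rewrite eqxx.
  have [_ l00 _ _] := ogd_init vbar rho info T v p.
  have -> : x v p 0 = true by rewrite ogd_xE.
  move: ss IH; rewrite l00 -[true%:R]/(1 : R) !mul1r mul0r; lra.
have av := accept_value t0 a; have dr := dual_regret t0 a.
have lc : lam v p t * cbar <= lam v p t * rho.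
  by rewrite ler_wpM2l//; have /andP[] := dual_box info T vbar_gt0 rho_gt0 bv bp t.
rewrite -[true%:R]/(1 : R) !mul1r; move: dr; rewrite -/(reg_rate t).
rewrite mulrBr [lam v p t * (_ - rho)]mulrBr; lra.
Qed.

(** Clipping only raises the multiplier, so [c_tilde] in excess of [rho] is bounded by its
    increments over the step size; these sum to at most [vbar * s t * lam]. The single [vbar] covers
    round 0, which leaves the multiplier unchanged, and the last sum undoes the confidence width
    subtracted in [c_tilde]. *)
Lemma budget_path t :
  rho * T%:R - bud v p t <=
    rho * \sum_(i < t) (act v p i)%:R + (0 < t)%N%:R * vbar + vbar * s t * lam v p t
    + overspend vbar rho G info T v p t + \sum_(i < t) jump (@cost R) v p i
    + \sum_(i < t) 2 * vbar * (eps_rate / s i).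
Proof.
have [_ l00 B0 _] := ogd_init vbar rho info T v p.
have er0 : 0 <= eps_rate := sqrtr_ge0 _.
elim: t => [|t IH].
  by rewrite /overspend !big_ord0 B0 l00 subrr !mulr0 mul0r !addr0.
rewrite /overspend !big_ord_recr /= -/(overspend vbar rho G info T v p t).
have jc0 := jump_ge0 (@cost R) t.
have d0 : 0 <= 2 * vbar * (eps_rate / s t).
  by rewrite !mulr_ge0 ?invr_ge0 ?(ltW vbar_gt0).
have /andP[l0 _] := dual_box info T vbar_gt0 rho_gt0 bv bp t.
have /andP[l0' _] := dual_box info T vbar_gt0 rho_gt0 bv bp t.+1.
have ss : vbar * s t * lam v p t <= vbar * s t.+1 * lam v p t.
  by rewrite ler_wpM2r// ler_wpM2l ?(ltW vbar_gt0)// le_sqrtn.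
have t1 : (0 < t)%N%:R * vbar <= vbar.
  by case: (0 < t)%N; rewrite ?mul1r// mul0r ltW.
have [a|na] := boolP (act v p t); last first.
  have [_ -> -> _] := ogd_inactiveE na; have [-> _] := ogd_inactive na.
  rewrite !mul0r !mul1r !addr0; lra.
have [_ lE -> _] := ogd_step a.
have /andP[cm0 cmv] := rowmean_box G vbar_gt0 (bmeas2_cost vbar) (@cost_box _ vbar) (bv t).
have /andP[v0 vv] := bv t.
have [t0|t0] := posnP t.
  subst t; have xt : x v p 0 = true by rewrite ogd_xE.
  have /andP[c0 cv] := cost_box (bv 0%N) (bp 0%N).
  have : 0 <= vbar * s 1 * lam v p 1.
    by rewrite mulr_ge0// mulr_ge0 ?(ltW vbar_gt0).
  move: IH; rewrite xt l00 -[true%:R]/(1 : R) !mul1r mul0r mulr0.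
  move: rho_gt0; lra.
have n0 := size_observed_gt0 vbar rho info T v p t0.
have jc := jump_ge (@cost R) a; have e0 := ogd_eps_ge0 (R := R) T (size (obs v p t)).
have eE := ler_wpM2l (ltW vbar_gt0) (ogd_eps_le t0 a).
have ev : ogd_eps R T (size (obs v p t)) * v t <= ogd_eps R T (size (obs v p t)) * vbar.
  by rewrite ler_wpM2l.
have ctE : cmean (v t) <= c_tilde T (obs v p t) p (v t)
    + jump (@cost R) v p t + 2 * vbar * (eps_rate / s t).
  move: jc; rewrite /c_tilde avg_dev// ler_norml => /andP[j1 j2]; lra.
have gE : (x v p t)%:R * c_tilde T (obs v p t) p (v t) - rho <=
    vbar * s t.+1 * (lam v p t.+1 - lam v p t).
  rewrite lE (gtn_eqF t0).
  have w0 : 0 < vbar * s t.+1 by rewrite mulr_gt0// sqrtn_gt0.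
  rewrite -ler_pdivrMl// lerBrDl le_max; by rewrite lexx.
rewrite t0 mul1r in IH *; rewrite -[true%:R]/(1 : R).
case: (x v p t) gE; rewrite -?[true%:R]/(1 : R) -?[false%:R]/(0 : R); lra.
Qed.

Lemma overspend_sqr t : overspend vbar rho G info T v p t ^+ 2 <=
  2 * \sum_(i < t) spend_mart vbar rho G info T i v p + t%:R * vbar ^+ 2.
Proof.
elim: t => [|t IH]; first by rewrite /overspend !big_ord0 expr0n mulr0 mul0r addr0.
rewrite {1}/overspend !big_ord_recr /= -/(overspend vbar rho G info T v p t).
rewrite -[t.+1%:R]natr1 /spend_mart.
have := sqr_centered_le G vbar_gt0 (bmeas2_cost vbar) (@cost_box _ vbar) (bv t) (bp t).
have := sqr_ge0 vbar.
set d := cost _ _ - _ => v2 d2.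
by case: (x v p t); rewrite ?mul1r ?mul0r ?mulr0 ?addr0; lra.
Qed.

Lemma inactive_budget t : ~~ act v p t -> bud v p t <= vbar.
Proof.
elim: t => [|t IH]; first by have [_ _ _ ->] := ogd_init vbar rho info T v p.
have [a|na] := boolP (act v p t); last first.
  by have [_ _ -> _] := ogd_inactiveE na; move=> _; exact: IH.
by have [_ _ _ ->] := ogd_step a; rewrite -ltNge => /ltW.
Qed.

Lemma active_all t i : act v p t -> (i <= t)%N -> act v p i.
Proof.
elim: t => [|t IH] a; first by rewrite leqn0 => /eqP->.
by rewrite leq_eqVlt => /predU1P[->//|]; apply: IH; exact: activeS a.
Qed.

End Path.
End OgdRegret.

(** * OGD-CB: expected revenue *)

Section OgdRevenue.
Context {R : realType}.
Variables (vbar rho : R) (F G : probability R R) (info : bool) (T : nat).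
Hypotheses (vbar_gt0 : 0 < vbar) (rho_gt0 : 0 < rho) (rho_le : rho <= vbar).
Hypotheses (F1 : F `[0, vbar]%classic = 1%E) (G1 : G `[0, vbar]%classic = 1%E).
Hypothesis T_large : vbar <= rho * T%:R.
Notation path := (nat -> R).
Notation s n := (Num.sqrt (n%:R : R)).
Notation act v p t := (active vbar rho info T v p t).
Let rbar := mean vbar F G (@rwd R).
Let cbar := mean vbar F G (@cost R).
Let k := obs_rate vbar rho.
Let Lam := dual_max vbar rho.
Let E := eps_rate vbar rho T.
Let c0 := dev_coef vbar rho.
Hypothesis cbar_le : cbar <= rho.

(** Errors in the cost estimates count twice: with weight at most [Lam] through the decisions, and
    with weight [vbar / rho] through the spending. *)
Definition ogd_mart (t : nat) (v p : path) : R :=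
  regret_mart vbar rho F G info T t v p
  - dev_mart vbar rho F G info T (@rwd R) t v p
  - (Lam + vbar / rho) * dev_mart vbar rho F G info T (@cost R) t v p
  - vbar / rho / (vbar * s T) * spend_mart vbar rho G info T t v p.

Lemma ogd_mart_adapted : adapted ogd_mart.
Proof.
move=> t v p v' p' vv pp; rewrite /ogd_mart.
rewrite (regret_mart_adapted _ _ F G info T vv pp) (spend_mart_adapted _ _ G info T vv pp).
by rewrite !(dev_mart_adapted _ _ F G info T _ vv pp).
Qed.

Lemma ogd_mart_diff : martingale_diff vbar F G T ogd_mart.
Proof.
move=> t a b _ ba bb; apply: centeredB => //.
  apply: centeredB => //; first apply: centeredB => //.
  - exact: regret_mart_centered.
  - by apply: dev_mart_centered => //; exact: bmeas2_rwd.
  - by apply: centeredZ => //; apply: dev_mart_centered => //; exact: bmeas2_cost.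
by apply: centeredZ => //; exact: spend_mart_centered.
Qed.

Definition dev_loss : R :=
  \sum_(i < T) (vbar / (2 * k) / s i + 4 * c0 * vbar ^+ 2 / s i.+1).

(** In the last bracket, [2 * vbar] is round 0 plus the budget left at stopping, [vbar * s T * Lam]
    the final multiplier over the step size, and the next [vbar * s T] the deterministic part of
    Young's inequality for [overspend]. *)
Definition ogd_loss : R :=
  Lam ^+ 2 * (vbar * s T) / 2 + \sum_(i < T) reg_rate vbar rho T i +
  (1 + Lam + vbar / rho) * dev_loss +
  vbar / rho * (2 * vbar + vbar * s T * Lam + vbar * s T
     + \sum_(i < T) 2 * vbar * (E / s i)).

Lemma ogd_path v p : inboxes vbar v -> inboxes vbar p ->
  (T%:R * rbar - ogd_loss) + \sum_(t < T) ogd_mart t v p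
    <= ogd_revenue info vbar rho T v p.
Proof.
move=> bv bp; have T0 := T_gt0 vbar_gt0 T_large.
have rb : 0 <= rbar <= vbar.
  by apply: mean_box => //; [exact: bmeas2_rwd|exact: rwd_box].
have sT0 := sqrtn_gt0 (R := R) T0.
have L1 : 1 <= Lam by exact: dual_max_ge1.
have vr0 : 0 < vbar / rho by rewrite divr_gt0.
pose a := vbar * s T; have a0 : 0 < a by rewrite mulr_gt0.
pose U : R := \sum_(i < T) (act v p i)%:R.
pose N := overspend vbar rho G info T v p T.
pose Jr := \sum_(i < T) dev_jump vbar rho G info T (@rwd R) v p i.
pose Jc := \sum_(i < T) dev_jump vbar rho G info T (@cost R) v p i.
pose M1 := \sum_(i < T) regret_mart vbar rho F G info T i v p.
pose M2 := \sum_(i < T) dev_mart vbar rho F G info T (@rwd R) i v p.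
pose M3 := \sum_(i < T) dev_mart vbar rho F G info T (@cost R) i v p.
pose M4 := \sum_(i < T) spend_mart vbar rho G info T i v p.
pose Ke := \sum_(i < T) 2 * vbar * (E / s i).
have martE : \sum_(t < T) ogd_mart t v p =
    M1 - M2 - (Lam + vbar / rho) * M3 - vbar / rho / a * M4.
  by rewrite /ogd_mart !sumrB -!mulr_sumr.
have Jle phi : bmeas2 vbar phi ->
    (forall u q, inbox vbar u -> inbox vbar q -> 0 <= phi u q <= u) ->
    \sum_(i < T) dev_jump vbar rho G info T phi v p i <=
    dev_loss + \sum_(i < T) dev_mart vbar rho F G info T phi i v p.
  move=> bphi pb; have := dev_path F G info T vbar_gt0 rho_gt0 rho_le bphi pb bv bp T.
  have : 0 <= 4 * c0 / s T * dvar vbar F G phi (observed vbar rho info T v p T) p.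
    apply: mulr_ge0; last exact: dvar_ge0.
    rewrite divr_ge0 ?(ltW sT0)//; apply: mulr_ge0 => //; apply: ltW.
    exact: dev_coef_gt0.
  rewrite -/k -/c0 -/dev_loss; lra.
have Jr_le : Jr <= dev_loss + M2 by apply: Jle; [exact: bmeas2_rwd|exact: rwd_box].
have Jc_le : Jc <= dev_loss + M3 by apply: Jle; [exact: bmeas2_cost|exact: cost_box].
have Jc0 : 0 <= Jc.
  by apply: sumr_ge0 => i _; rewrite /dev_jump !mulr_ge0 ?invr_ge0.
have Ke0 : 0 <= Ke.
  apply: sumr_ge0 => i _; apply: mulr_ge0; first by rewrite mulr_ge0// ltW.
  by rewrite divr_ge0// sqrtr_ge0.
have reg := regret_path info vbar_gt0 rho_gt0 rho_le T_large cbar_le bv bp T.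
have U_le : 0 <= T%:R - U.
  rewrite subr_ge0 -[T in T%:R]card_ord -sum1_card natr_sum /U.
  by apply: ler_sum => t _; rewrite lern1 leq_b1.
have lam2 : 0 <= dual vbar rho info T v p T ^+ 2 := sqr_ge0 _.
have lost : (T%:R - U) * rbar <= vbar / rho *
    (2 * vbar + a * Lam + (a / 2 + N ^+ 2 / (2 * a)) + Jc + Ke).
  apply: lost_rounds_le => //.
  have N2 : 0 <= N ^+ 2 / (2 * a) by rewrite divr_ge0 ?sqr_ge0// mulr_ge0// ltW.
  have aL : 0 <= a * Lam by rewrite mulr_ge0 ?(ltW a0)//; lra.
  have [aT|naT] := boolP (act v p T).
    have -> : U = T%:R.
      rewrite /U -[T in RHS]card_ord -sum1_card natr_sum.
      by apply: eq_bigr => t _; rewrite (active_all aT (ltnW (ltn_ord t))).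
    by rewrite subrr mulr0; move: vbar_gt0; lra.
  have N_le : N <= a / 2 + N ^+ 2 / (2 * a).
    have -> : a / 2 + N ^+ 2 / (2 * a) = N + (a - N) ^+ 2 / (2 * a).
      by field; rewrite gt_eqF.
    by rewrite lerDl divr_ge0 ?sqr_ge0// mulr_ge0// ltW.
  have bT := inactive_budget naT.
  have := budget_path G info vbar_gt0 rho_gt0 rho_le T_large bv bp T.
  rewrite T0 mul1r -/N -/Jc -/Ke -/U -/a.
  have /andP[_ lL] := dual_box info T vbar_gt0 rho_gt0 bv bp T.
  have := ler_wpM2l (ltW a0) lL; rewrite -/Lam; lra.
have aa : a ^+ 2 = T%:R * vbar ^+ 2 by rewrite /a exprMn sqr_sqrtn mulrC.
have Nsq : N ^+ 2 <= 2 * M4 + a ^+ 2.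
  by rewrite aa; exact: (overspend_sqr rho G info T vbar_gt0 bv bp).
have N2 : N ^+ 2 / (2 * a) <= M4 / a + a / 2.
  have -> : M4 / a + a / 2 = (2 * M4 + a ^+ 2) / (2 * a) by field; rewrite gt_eqF.
  by rewrite ler_wpM2r// invr_ge0 mulr_ge0// ltW.
have lost' : vbar / rho * (2 * vbar + a * Lam + (a / 2 + N ^+ 2 / (2 * a)) + Jc + Ke)
    <= vbar / rho * (2 * vbar + a * Lam + a + Ke) + vbar / rho * (dev_loss + M3)
       + vbar / rho / a * M4.
  have -> : vbar / rho / a * M4 = vbar / rho * (M4 / a) by ring.
  by rewrite -!mulrDr ler_wpM2l ?(ltW vr0)//; lra.
have LJ : Lam * Jc <= Lam * (dev_loss + M3) by rewrite ler_wpM2l//; lra.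
rewrite martE /ogd_loss -/a -/Ke; move: reg.
rewrite -/U -/M1 -/Jr -/Jc -/rbar -/Lam -/a.
have : 0 <= a / 2 * dual vbar rho info T v p T ^+ 2.
  by rewrite mulr_ge0// divr_ge0// ltW.
rewrite /ogd_revenue; lra.
Qed.

Lemma E_ogd_ge : ((T%:R * rbar - ogd_loss)%:E <= E_ogd F G info vbar rho T)%E.
Proof.
apply: (expect_vp_lb vbar_gt0 F1 G1 _ ogd_mart_adapted ogd_mart_diff) => v p bv bp.
  by apply: sumr_ge0 => t _; rewrite mulr_ge0// rwd_ge0.
exact: ogd_path.
Qed.

Lemma E_ogd_le : (E_ogd F G info vbar rho T <= (T%:R * rbar)%:E)%E.
Proof.
rewrite -[X in (_ <= X%:E)%E]add0r; apply: expect_vp_ub => //.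
- exact: bmeas2_rwd.
- by move=> v p bv bp; apply: sumr_ge0 => t _; rewrite mulr_ge0// rwd_ge0.
- move=> v p bv bp; rewrite add0r; apply: ler_sum => t _.
  by rewrite ler_piMl ?rwd_ge0// lern1 leq_b1.
Qed.

(** [E ^+ 2] is of order [ln T]. It enters the regret against a bounded sum, and the spending as
    [E * s T], the one term of full order [S]. The 3 in the constants comes from
    [ln 2 <= 1 <= ln T]. *)
Lemma ogd_loss_rate (S : R) : 1 <= ln (T%:R : R) ->
  S = Num.sqrt (T%:R * ln T%:R) ->
  ogd_loss <= (Lam ^+ 2 * vbar / 2 + 4 * vbar * (2 + 4 * (3 / (2 * k))) +
    (1 + Lam + vbar / rho) * (vbar / k + 8 * c0 * vbar ^+ 2) +
    vbar / rho * (2 * vbar + vbar * Lam + vbar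
      + 4 * vbar * Num.sqrt (3 / (2 * k)))) * S.
Proof.
move=> lnT SE; have T0 := T_gt0 vbar_gt0 T_large.
have k0 : 0 < k := obs_rate_gt0 vbar_gt0 rho_gt0.
have c00 : 0 < c0 := dev_coef_gt0 vbar_gt0 rho_gt0.
have L1 : 1 <= Lam by exact: dual_max_ge1.
have vr0 : 0 < vbar / rho by rewrite divr_gt0.
have T1 : 1 <= T%:R :> R by rewrite ler1n.
have ln0 : 0 <= ln (T%:R : R) by lra.
have sS : s T <= S.
  by rewrite SE ler_wsqrtr// ler_peMr.
have S1 : 1 <= S by apply: le_trans sS; exact: sqrtn_ge1.
have lnS : ln (T%:R : R) <= S.
  have -> : ln (T%:R : R) = Num.sqrt (ln T%:R * ln T%:R).
    by rewrite -expr2 sqrtr_sqr ger0_norm.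
  by rewrite SE ler_wsqrtr// ler_wpM2r// ltW// ln_sublinear// ltr0n.
have L3 : ln 2 + 2 * ln (T%:R : R) <= 3 * ln T%:R.
  have : ln (1 + 1 : R) <= 1 by apply: le_ln1Dx; lra.
  by rewrite -[1 + 1]/(2 : R); lra.
have L0 : 0 <= ln 2 + 2 * ln (T%:R : R).
  by rewrite addr_ge0 ?mulr_ge0// ln_ge0// ler1n.
have k20 : 0 < 2 * k by rewrite mulr_gt0.
have ratio : (ln 2 + 2 * ln (T%:R : R)) / (2 * k) <= 3 / (2 * k) * ln T%:R.
  by rewrite mulrAC ler_wpM2r// invr_ge0 ltW.
have E0 : 0 <= E := sqrtr_ge0 _.
have k30 : 0 <= 3 / (2 * k) by rewrite divr_ge0// ltW.
have E2 : E ^+ 2 <= 3 / (2 * k) * S.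
  rewrite /E /eps_rate sqr_sqrtr ?divr_ge0 ?(ltW k20)//.
  by apply: le_trans ratio _; rewrite ler_wpM2l.
have ES : E * s T <= Num.sqrt (3 / (2 * k)) * S.
  rewrite SE mulrC [T%:R * ln _]mulrC [Num.sqrt (ln _ * _)]sqrtrM// mulrA mulrC.
  by rewrite ler_wpM2r// -sqrtrM// ler_wsqrtr.
have Kr : \sum_(i < T) reg_rate vbar rho T i <= 4 * vbar * (2 + 4 * (3 / (2 * k))) * S.
  rewrite /reg_rate -mulr_sumr big_split /= -mulr_sumr -[leRHS]mulrA.
  rewrite ler_wpM2l ?mulr_ge0 ?(ltW vbar_gt0)// mulrDl lerD//.
    by apply: le_trans (sum_inv_sqrtS T) _; rewrite ler_wpM2l.
  have -> : 4 * (3 / (2 * k)) * S = 3 / (2 * k) * S * 4 by ring.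
  by rewrite ler_pM ?sqr_ge0 ?sumr_ge0// ?sum_inv_nsqrt// => i _; rewrite invr_ge0 mulr_ge0.
have Kj : dev_loss <= (vbar / k + 8 * c0 * vbar ^+ 2) * S.
  rewrite /dev_loss big_split /= -!mulr_sumr.
  have c1 : 0 <= vbar / (2 * k) by rewrite divr_ge0 ?ltW.
  have c2 : 0 <= 4 * c0 * vbar ^+ 2 by rewrite mulr_ge0 ?sqr_ge0// mulr_ge0// ltW.
  have := ler_wpM2l c1 (le_trans (sum_inv_sqrt T) (ler_wpM2l (ler0n _ 2) sS)).
  have := ler_wpM2l c2 (le_trans (sum_inv_sqrtS T) (ler_wpM2l (ler0n _ 2) sS)).
  have -> : vbar / (2 * k) * (2 * S) = vbar / k * S by field; rewrite gt_eqF.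
  lra.
have Ke : \sum_(i < T) 2 * vbar * (E / s i) <= 4 * vbar * Num.sqrt (3 / (2 * k)) * S.
  rewrite -!mulr_sumr; have := ler_wpM2l E0 (sum_inv_sqrt (R := R) T).
  move=> h; have v2 : 0 <= 2 * vbar by rewrite mulr_ge0// ltW.
  have := ler_wpM2l v2 h; have := ler_wpM2l v2 ES; lra.
have sS1 : vbar * s T <= vbar * S by rewrite ler_wpM2l// ltW.
have sS2 : vbar * s T * Lam <= vbar * S * Lam by rewrite ler_wpM2r//; lra.
have sS3 : Lam ^+ 2 * (vbar * s T) <= Lam ^+ 2 * (vbar * S).
  by rewrite ler_wpM2l ?sqr_ge0.
have vS : 2 * vbar * 1 <= 2 * vbar * S by rewrite ler_wpM2l ?mulr_ge0 ?(ltW vbar_gt0).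
have j0 : 0 <= 1 + Lam + vbar / rho by lra.
have := ler_wpM2l j0 Kj.
have := ler_wpM2l (ltW vr0) (lerD (lerD (lerD vS sS2) sS1) Ke).
rewrite /ogd_loss mulr1; lra.
Qed.

End OgdRevenue.

(** * Comparison of the three revenues *)

Lemma abse_diff_le (R : realType) (a b : \bar R) (m K1 K2 K : R) :
  ((m - K1)%:E <= a)%E -> (a <= m%:E)%E -> ((m - K2)%:E <= b)%E ->
  (b <= m%:E)%E -> K1 <= K -> K2 <= K -> (`|a - b| <= K%:E)%E.
Proof.
move: a b => [a| |] [b| |] //; rewrite !lee_fin => ? ? ? ? ? ?.
by rewrite ler_norml; lra.
Qed.

(** Both sides of the step-size condition are used: the lower one bounds [e^-1] by [S / c1], the
    upper one bounds [T * e] by [c2 * S]. *)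
Lemma pac_loss_rate (R : realType) (vbar rho c1 c2 e mubar S : R) (T : nat) :
  0 < vbar -> 0 < rho -> 0 < c1 -> 0 <= mubar ->
  (0 < T)%N -> c1 / Num.sqrt T%:R <= e <= c2 / Num.sqrt T%:R ->
  Num.sqrt T%:R <= S ->
  pac_loss vbar rho e mubar T <=
  (mubar ^+ 2 / (2 * c1) + c2 * vbar ^+ 2 / 2 + vbar / rho * (vbar + mubar / c1)) * S.
Proof.
move=> v0 r0 c10 m0 T0 /andP[e1 e2] sS.
have sT0 := sqrtn_gt0 (R := R) T0; set s := Num.sqrt _ in e1 e2 sS sT0.
have s1 : 1 <= s := sqrtn_ge1 T0.
have e0 : 0 < e by apply: lt_le_trans e1; rewrite divr_gt0.
have ie : e^-1 <= S / c1.
  apply: (@le_trans _ _ (s / c1)); last by rewrite ler_wpM2r// invr_ge0 ltW.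
  by rewrite -[s / c1]invrK invf_div lef_pV2// posrE divr_gt0.
have Te : T%:R * e <= c2 * S.
  have -> : (T%:R : R) = s ^+ 2 by rewrite /s sqr_sqrtn.
  have c20 : 0 <= c2.
    by rewrite -(pmulr_lge0 _ (_ : 0 < s^-1)) ?invr_gt0// (le_trans (ltW e0)).
  apply: (@le_trans _ _ (s ^+ 2 * (c2 / s))); first by rewrite ler_wpM2l ?sqr_ge0.
  have -> : s ^+ 2 * (c2 / s) = c2 * s by field; rewrite gt_eqF.
  by rewrite ler_wpM2l.
rewrite /pac_loss [leRHS]mulrDl [X in _ <= X + _]mulrDl.
have vS : vbar <= vbar * S by rewrite ler_peMr ?(ltW v0)// (le_trans s1).
apply: lerD; first apply: lerD.
- have -> : mubar ^+ 2 / (2 * e) = mubar ^+ 2 / 2 * e^-1 by field; rewrite gt_eqF.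
  have -> : mubar ^+ 2 / (2 * c1) * S = mubar ^+ 2 / 2 * (S / c1) by field; rewrite gt_eqF.
  by rewrite ler_wpM2l// divr_ge0 ?sqr_ge0.
- have h : 0 <= vbar ^+ 2 / 2 by rewrite divr_ge0 ?sqr_ge0.
  by have := ler_wpM2l h Te; lra.
rewrite -[leRHS]mulrA ler_wpM2l ?divr_ge0 ?(ltW v0) ?(ltW r0)// mulrDl lerD//.
by rewrite -mulrA [c1^-1 * S]mulrC ler_wpM2l.
Qed.

Lemma greedy_loss_rate (R : realType) (vbar rho S : R) (T : nat) :
  0 < vbar -> 0 < rho -> (0 < T)%N -> Num.sqrt T%:R <= S ->
  greedy_loss vbar rho T <= vbar / rho * (2 * vbar) * S.
Proof.
move=> v0 r0 T0 sS; have s1 : 1 <= S := le_trans (sqrtn_ge1 T0) sS.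
rewrite /greedy_loss -[leRHS]mulrA ler_wpM2l ?divr_ge0 ?(ltW v0) ?(ltW r0)//.
have := ler_wpM2l (ltW v0) sS; have := ler_wpM2l (ltW v0) s1; lra.
Qed.

Theorem theorem10 (R : realType) (vbar rho : R) (F G : probability R R)
    (info : bool) (eps : nat -> R) (mubar mu1 : R) :
  0 < vbar -> 0 < rho -> rho <= vbar ->
  F `[0, vbar]%classic = 1%E -> G `[0, vbar]%classic = 1%E ->
  (\int[F]_v \int[G]_p (cost v p)%:E <= rho%:E)%E ->
  (exists c1 c2 : R, 0 < c1 /\ 0 < c2 /\
     forall T : nat, (0 < T)%N ->
       c1 / Num.sqrt T%:R <= eps T <= c2 / Num.sqrt T%:R) ->
  vbar / rho <= mubar -> 0 <= mu1 <= mubar ->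
  exists (C : R) (T0 : nat), 0 < C /\
    forall T : nat, (T0 <= T)%N ->
      (`| E_thr F G vbar rho T info - E_pac F G (eps T) mubar mu1 rho T |
         <= (C * Num.sqrt (T%:R * ln T%:R))%:E)%E /\
      (`| E_ogd F G info vbar rho T - E_pac F G (eps T) mubar mu1 rho T |
         <= (C * Num.sqrt (T%:R * ln T%:R))%:E)%E.
Proof.
move=> v0 r0 rv F1 G1 Ec [c1 [c2 [c10 [c20 epsE]]]] mub mu1b.
have cbar_le : mean vbar F G (@cost R) <= rho.
  by move: Ec; rewrite (E_cost v0)// lee_fin.
have m0 : 0 <= mubar by case/andP: mu1b => /le_trans; exact.
set k := obs_rate vbar rho; set Lam := dual_max vbar rho.
pose Kp := mubar ^+ 2 / (2 * c1) + c2 * vbar ^+ 2 / 2 + vbar / rho * (vbar + mubar / c1).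
pose Kg := vbar / rho * (2 * vbar).
pose Ko := Lam ^+ 2 * vbar / 2 + 4 * vbar * (2 + 4 * (3 / (2 * k))) +
    (1 + Lam + vbar / rho) * (vbar / k + 8 * dev_coef vbar rho * vbar ^+ 2) +
    vbar / rho * (2 * vbar + vbar * Lam + vbar + 4 * vbar * Num.sqrt (3 / (2 * k))).
pose C := Num.max (Num.max Kp Kg) (Num.max Ko 1).
have Cp : Kp <= C by rewrite !le_max lexx.
have Cg : Kg <= C by rewrite !le_max lexx !orbT.
have Co : Ko <= C by rewrite !le_max lexx !orbT.
have C0 : 0 < C by rewrite (@lt_le_trans _ _ 1)// !le_max lexx !orbT.
pose bnd (x : R) := Num.bound x.
(* The three thresholds give [1 <= ln T], an initial budget of at least [vbar], and
   [eps T * vbar <= 1]. *)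
exists C, (bnd (expR 1) + bnd (vbar / rho) + bnd ((c2 * vbar) ^+ 2))%N; split=> // T hT.
have ge_bnd x : 0 <= x -> (bnd x <= T)%N -> x <= T%:R.
  by move=> x0 xT; apply: ltW; apply: lt_le_trans (archi_boundP x0) _; rewrite ler_nat.
have Te : expR 1 <= T%:R :> R.
  by apply: ge_bnd; [exact: expR_ge0|rewrite (leq_trans _ hT)// -addnA leq_addr].
have Tr : vbar <= rho * T%:R.
  rewrite mulrC -ler_pdivrMr//; apply: ge_bnd; first by rewrite divr_ge0// ltW.
  by rewrite (leq_trans _ hT)// addnAC leq_addl.
have Tc : (c2 * vbar) ^+ 2 <= T%:R.
  by apply: ge_bnd; [exact: sqr_ge0|rewrite (leq_trans _ hT)// leq_addl].
have T0 : (0 < T)%N := T_gt0 v0 Tr.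
have sT0 := sqrtn_gt0 (R := R) T0.
have lnT : 1 <= ln (T%:R : R) by rewrite -[leLHS]expRK ler_ln ?posrE ?expR_gt0 ?ltr0n.
set S := Num.sqrt _.
have sS : Num.sqrt (T%:R : R) <= S by rewrite ler_wsqrtr// ler_peMr.
have S0 : 0 <= S := sqrtr_ge0 _.
have eT := epsE T T0; have /andP[e1 e2] := eT.
have e0 : 0 < eps T by apply: lt_le_trans e1; rewrite divr_gt0.
have ev : eps T * vbar <= 1.
  apply: (@le_trans _ _ (c2 / Num.sqrt T%:R * vbar)); first by rewrite ler_wpM2r// ltW.
  rewrite mulrAC ler_pdivrMr// mul1r -(ler_pXn2r (ltn0Sn 1)) ?nnegrE ?sqrtr_ge0//.
    by rewrite sqr_sqrtn.
  by rewrite mulr_ge0// ltW.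
have pge := E_pac_ge v0 r0 rv F1 G1 e0 ev mub mu1b cbar_le Tr.
have ple := E_pac_le rho v0 F1 G1 (eps T) mu1b T.
have lossC K L : L <= K * S -> K <= C -> L <= C * S.
  by move=> LK KC; apply: le_trans LK _; rewrite ler_wpM2r.
have Lp := lossC _ _ (pac_loss_rate v0 r0 c10 m0 T0 eT sS) Cp.
split.
  apply: (abse_diff_le _ _ pge ple _ Lp).
  - exact: E_thr_ge.
  - exact: E_thr_le.
  - exact: lossC (greedy_loss_rate v0 r0 T0 sS) Cg.
apply: (abse_diff_le _ _ pge ple _ Lp).
- exact: E_ogd_ge v0 r0 rv F1 G1 Tr cbar_le.
- exact: E_ogd_le.
- by apply: lossC Co; exact: ogd_loss_rate.
Qed.
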